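(* Let $\alpha\ge-1/2$ and let $\nu,\mu\in\mathbb{R}$ be such that $0<\mu+\nu<\alpha+3/2$. Let $f$ be a $GM$ function such that $t^\nu f(t)\in L^1(0,1)$. 1. If $|f(M)|=o(M^{\mu-1})$ as $M\to\infty$, then $\mathcal{L}^{\alpha}_{\nu,\mu}f$ converges uniformly on $\mathbb{R}_+$. 2. If $f\ge0$ and $\mathcal{L}^{\alpha}_{\nu,\mu}f$ converges uniformly on $\mathbb{R}_+$, then $|f(M)|=o(M^{\mu-1})$ as $M\to\infty$.
   Context: $\mathbb{R}_+=[0,\infty)$. For $\alpha\ge-1/2$, $j_\alpha(z)=\Gamma(\alpha+1)(z/2)^{-\alpha}J_\alpha(z)$ is the normalized Bessel function, where $J_\alpha$ is the Bessel function of the first kind of order $\alpha$ (so $j_\alpha(0)=1$). Standing assumption: $f:\mathbb{R}_+\to\mathbb{C}$ is locally of bounded variation and locally integrable on $(0,\infty)$. Integrals against $|df(t)|$ are Stieltjes integrals with respect to the total variation of $f$. Definition ($GM$, general monotone): $f\in GM$ if there exist constants $C,\lambda>1$ such that for every $x>0$, $\int_x^{2x}|df(t)|\le \frac{C}{x}\int_{x/\lambda}^{\lambda x}|f(t)|\,dt$. The transform is $\mathcal{L}^{\alpha}_{\nu,\mu}f(r)=r^\mu\int_0^\infty (rt)^\nu f(t)j_\alpha(rt)\,dt$, where $\int_0^\infty=\lim_{N\to\infty}\int_0^N$ and $r^\mu(rt)^\nu$ is read as $r^{\mu+\nu}t^\nu$ (so when $\mu+\nu>0$ the partial integrals are $0$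 at $r=0$). It converges uniformly on a set $E\subset\mathbb{R}_+$ if the partial integrals $r^{\mu}\int_0^N (rt)^\nu f(t)j_\alpha(rt)\,dt$ converge uniformly in $r\in E$ as $N\to\infty$, equivalently $r^{\mu}\int_M^N (rt)^\nu f(t)j_\alpha(rt)\,dt\to0$ uniformly in $r\in E$ as $N>M\to\infty$. *)

(* Defs.v *)
From HB Require Import structures.
From mathcomp Require Import all_boot all_order all_algebra complex.
From mathcomp Require Import all_classical all_reals all_analysis.
Set Implicit Arguments.
Unset Strict Implicit.
Unset Printing Implicit Defensive.
Import Order.TTheory GRing.Theory Num.Theory.
Import numFieldNormedType.Exports.
Local Open Scope classical_set_scope.
Local Open Scope ring_scope.
Local Open Scope complex_scope.

(* A function on [0, +oo[ is represented by a total function on R;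
   GM, hankel etc. only depend on its values there. *)

(* Lets the Landau notations be used at +oo. *)
Canonical pinfty_filter_on (R : numFieldType) :=
  FilterType (pinfty_nbhs R) _.

Section complex_valued.
Context {R : realType}.
Implicit Types (a b : R) (f g : R -> R[i]) (D : set R).

Local Notation leb := (@lebesgue_measure R).
Local Notation modulus := (@ComplexField.Normc.normc R).

(* Complex integration with respect to the Lebesgue measure is componentwise. *)
Definition cintegrable D g :=
  leb.-integrable D (EFin \o (fun t => complex.Re (g t))) /\
  leb.-integrable D (EFin \o (fun t => complex.Im (g t))).

Definition cintegral D g : R[i] :=
  Rintegral leb D (fun t => complex.Re (g t)) +i*
  Rintegral leb D (fun t => complex.Im (g t)).

Definition clocally_integrable D f :=
  locally_integrable D (fun t => complex.Re (f t)) /\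
  locally_integrable D (fun t => complex.Im (f t)).

(* Complex-valued counterparts of variation, variations, bounded_variation
   and total_variation. *)
Definition cvariation a b f (s : seq R) : R :=
  let F := f \o nth b (a :: s) in
  \sum_(0 <= n < size s) modulus (F n.+1 - F n).

Definition cvariations a b f : set R :=
  [set cvariation a b f s | s in itv_partition a b].

Definition cbounded_variation a b f := has_ubound (cvariations a b f).

(* The Stieltjes integral of the constant 1 over [a, b] against |df|, that is,
   the increment over [a, b] of the variation function of f. *)
Definition ctotal_variation a b f : \bar R :=
  ereal_sup [set x%:E | x in cvariations a b f].

Definition locally_bounded_variation f :=
  forall a b, 0 < a -> a < b -> cbounded_variation a b f.

Definition GM f :=
  exists C lambda : R, [/\ 1 < C, 1 < lambda &
    forall x : R, 0 < x ->
      (ctotal_variation x (2 * x)%R f <=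
       (C / x)%:E * \int[leb]_(t in `[(x / lambda)%R, (lambda * x)%R])
                      (modulus (f t))%:E)%E].

End complex_valued.

Section hankel.
Context {R : realType}.
Implicit Types (alpha nu mu z r N x : R) (f : R -> R[i]).

(* Only meaningful for 0 < x. *)
Definition Gamma x : R :=
  Rintegral (@lebesgue_measure R) `]0, +oo[
    (fun t => t `^ (x - 1) * expR (- t)).

(* Only meaningful for 0 < z and -1 < alpha. *)
Definition besselJ alpha z : R :=
  limn (series (fun m : nat =>
    (-1) ^+ m / (m`!%:R * Gamma (m%:R + alpha + 1)) *
    (z / 2) `^ (2 * m%:R + alpha))).

(* The value at 0 is set by continuity. *)
Definition besselj alpha z : R :=
  if z == 0 then 1
  else Gamma (alpha + 1) * (z / 2) `^ (- alpha) * besselJ alpha z.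

(* The factor r^mu (r t)^nu is written r^(mu + nu) t^nu; for mu + nu > 0 it
   vanishes at r = 0, since 0 `^ p = 0 for p != 0. The codomain is R[i]^o to
   give access to the topology of R[i] as a normed module over itself. *)
Definition partial_hankel alpha nu mu f N r : R[i]^o :=
  (r `^ (mu + nu))%:C *
  cintegral `[0, N] (fun t => (t `^ nu * besselj alpha (r * t))%:C * f t).

Definition hankel alpha nu mu f r : R[i]^o :=
  lim (partial_hankel alpha nu mu f N r @[N --> +oo]).

Definition hankel_converges_uniformly alpha nu mu f (E : set R) :=
  {uniform E,
     partial_hankel alpha nu mu f @ +oo --> hankel alpha nu mu f}.

End hankel.

(* Main.v *)
Require Import Defs.
From HB Require Import structures.
From mathcomp Require Import all_boot all_order all_algebra complex.
From mathcomp Require Import all_classical all_reals all_analysis.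
From mathcomp Require Import measurable_realfun ring lra.
Set Implicit Arguments.
Unset Strict Implicit.
Unset Printing Implicit Defensive.
Import Order.TTheory GRing.Theory Num.Theory.
Import numFieldNormedType.Exports.
Local Open Scope classical_set_scope.
Local Open Scope ring_scope.
Local Open Scope complex_scope.

(* Write j for the normalized Bessel function, s = mu + nu, p = alpha + 1/2.

   The energies j^2 + j'^2 and (u^2 + u'^2) exp(c / z), with u = z^p j, decrease
   along Bessel's equation; hence |j| <= 1 and j, j' = O(z^-p).  Since
   t^nu j(rt) is nearly the derivative of - t^nu j'(rt) / r, its integral over a
   subinterval of [x, 2x] with r x >= 1 is O(x^nu r^-1 (rx)^-p).

   Sufficiency: integrating by parts against df over a dyadic block, where the
   total variation is o(x^(mu-1)) by GM, gives o(1) (rx)^(s - alpha - 3/2), which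
   sums geometrically over the blocks with r x >= 1; for r t <= 1 the bound |j| <= 1
   suffices since s > 0.

   Necessity: for f >= 0 take r = c / N with j >= 1/2 on [0, c]; the Cauchy
   condition gives a bound o(N^mu) for the integral of f over [N / L, N], and GM turns
   this average into a pointwise bound. *)

(** * Calculus and the Gamma function *)

(** Cancellation is indispensable for sufficiency: with absolute values, the decay of j only bounds
    the block at x by (r x)^(s - alpha - 1/2), which need not be summable when s < alpha + 3/2.
    Integrating the kernel before taking absolute values gains a factor (r x)^-1; the price is the
    total variation of f on the block, which GM bounds by x^(mu-1), the same order as f itself.
    Uniformity in r comes from homogeneity: the prefactor r^s makes every estimate depend on r and x
    through r x only.

    For necessity the Cauchy condition only sees averages of f. Nonnegativity forbids cancellation
    where the kernel is bounded below, and GM limits how far f can drop from its value at x within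
    [x, 2 x].

    Of the Gamma function only positivity and Gamma (x + 1) = x Gamma x are required: they turn the
    defining series into a two-term recurrence, and the recurrence into a differential equation,
    from which all size estimates follow. *)

Section tools.
Context {R : realType}.
Implicit Types (a b x y : R).
Local Notation leb := (@lebesgue_measure R).

Lemma continuous_integrable_itv (f : R -> R) a b :
  {in `[a, b], continuous f} -> leb.-integrable `[a, b] (EFin \o f).
Proof.
move=> cf; apply: continuous_compact_integrable; first exact: segment_compact.
by apply: continuous_in_subspaceT => x; rewrite inE => /cf.
Qed.

Lemma FTC2 (F f : R -> R) a b : a <= b ->
  (forall x, x \in `[a, b] -> is_derive x 1 F (f x)) ->
  {in `[a, b], continuous f} ->
  (\int[leb]_(x in `[a, b]) (f x)%:E = (F b - F a)%:E)%E.
Proof.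
rewrite le_eqVlt => /predU1P[<- _ _|ab dF cf].
  by rewrite set_itv1 integral_set1 subrr.
have dF1 x : x \in `[a, b] -> differentiable F x.
  by move=> /dF d; apply/derivable1_diffP; apply: ex_derive.
rewrite (@continuous_FTC2 _ f F)//.
- by apply: continuous_in_subspaceT => x; rewrite inE => /cf.
- split => [x xab| |].
  + by apply: ex_derive; apply: dF; apply: subset_itv_oo_cc xab.
  + apply/cvg_at_right_filter; apply: differentiable_continuous; apply: dF1.
    by rewrite bound_itvE ltW.
  + apply/cvg_at_left_filter; apply: differentiable_continuous; apply: dF1.
    by rewrite bound_itvE ltW.
- move=> x xab; rewrite derive1E; apply: derive_val; apply: dF.
  exact: subset_itv_oo_cc xab.
Qed.

Lemma le_itv_of_derive (F f : R -> R) a b : a <= b ->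
  (forall x, x \in `[a, b] -> is_derive x 1 F (f x)) ->
  (forall x, x \in `[a, b] -> 0 <= f x) -> F a <= F b.
Proof.
move=> ab dF f0.
have cF : {within `[a, b], continuous F}.
  apply: derivable_within_continuous => x /dF d; exact: ex_derive.
have dF' x : x \in `]a, b[ -> is_derive x 1 F (f x).
  by move=> xab; apply: dF; exact: subset_itv_oo_cc xab.
have [c cab e] := MVT_segment ab dF' cF.
by rewrite -subr_ge0 e mulr_ge0 ?subr_ge0// f0.
Qed.

End tools.

Section gamma.
Context {R : realType}.
Local Notation leb := (@lebesgue_measure R).
Implicit Types (x t : R).

Definition gammai x t : R := t `^ (x - 1) * expR (- t).

Lemma gammai_ge0 x t : 0 <= gammai x t.
Proof. by rewrite mulr_ge0 ?powR_ge0 ?expR_ge0. Qed.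

Lemma one_powR (p : R) : 1 `^ p = 1 :> R.
Proof. by rewrite powR1. Qed.

Lemma powR_continuous_at (p t : R) : 0 < t -> {for t, continuous ((fun s => s `^ p) : R -> R)}.
Proof.
move=> t0; apply: differentiable_continuous; apply/derivable1_diffP.
by have := is_derive1_powR p t0 => -[].
Qed.

Lemma gammai_continuous x t : 0 < t -> {for t, continuous (gammai x)}.
Proof.
move=> t0; apply: continuousM; first exact: powR_continuous_at.
apply: continuous_comp; first exact: continuousN.
exact: continuous_expR.
Qed.

(** One compact exhaustion handles both improper ends, the possible singularity at 0 and infinity;
    on each piece the integrand is continuous. *)
Definition growing_itv (n : nat) : set R := `[n.+1%:R^-1, n.+1%:R].

Lemma growing_itv_gt0 n t : growing_itv n t -> 0 < t.
Proof.
by rewrite /growing_itv/= in_itv/= => /andP[h _]; apply: lt_le_trans h.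
Qed.

Lemma nd_growing_itv : nondecreasing_seq growing_itv.
Proof.
move=> m n mn; apply/subsetPset => t; rewrite /growing_itv/= !in_itv/=.
move=> /andP[h1 h2]; apply/andP; split.
  by apply: le_trans h1; rewrite lef_pV2 ?posrE ?ler_nat.
by apply: le_trans h2 _; rewrite ler_nat.
Qed.

Lemma bigcup_growing_itv : \bigcup_n growing_itv n = `]0, +oo[%classic.
Proof.
apply/seteqP; split => t.
  by move=> [n _ /growing_itv_gt0]/=; rewrite in_itv/= andbT.
rewrite /= in_itv/= andbT => t0.
pose n := Num.bound (t + t^-1); exists n => //=.
rewrite /growing_itv/= in_itv/=.
have h : t + t^-1 < n.+1%:R.
  apply: lt_trans (archi_boundP _) _; last by rewrite ltr_nat.
  by rewrite addr_ge0// ?invr_ge0 ltW.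
have ti : 0 < t^-1 by rewrite invr_gt0.
apply/andP; split; last by apply: ltW; apply: le_lt_trans h; rewrite lerDl ltW.
rewrite -[leRHS]invrK lef_pV2 ?posrE//.
by apply: ltW; apply: le_lt_trans h; rewrite lerDr ltW.
Qed.

Definition gammae x := (\int[leb]_(t in `]0%R, +oo[) (gammai x t)%:E)%E.

Lemma growing_integral_cvg x :
  (\int[leb]_(t in growing_itv n) (gammai x t)%:E @[n --> \oo] --> gammae x)%E.
Proof.
rewrite /gammae -bigcup_growing_itv.
have := @ge0_nondecreasing_set_cvg_integral _ (measurableTypeR R) R growing_itv
  (fun t => (gammai x t)%:E) leb nd_growing_itv; apply.
- by move=> i; exact: measurable_itv.
- move=> i; apply: (measurable_int leb).
  apply: (@continuous_integrable_itv _ (gammai x)) => t /growing_itv_gt0.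
  exact: gammai_continuous.
- by move=> i t _; rewrite lee_fin gammai_ge0.
Qed.

Lemma derive_gammai x t : 0 < t ->
  is_derive t 1 (fun t => t `^ x * expR (- t))
    (x * gammai x t - gammai (x + 1) t).
Proof.
move=> t0; have ? := is_derive1_powR x t0.
apply: is_derive_eq; rewrite /gammai addrK.
by rewrite /GRing.scale/=; ring.
Qed.


(** Integration by parts on a compact piece, through [derive_gammai]. The boundary term tends to 0
    when x > 0, which gives the functional equation in [GammaD1]. *)
Lemma growing_integral_gammai x n :
  (\int[leb]_(t in growing_itv n) (gammai (x + 1) t)%:E =
   x%:E * \int[leb]_(t in growing_itv n) (gammai x t)%:E -
   (n.+1%:R `^ x * expR (- n.+1%:R) -
    n.+1%:R^-1 `^ x * expR (- n.+1%:R^-1))%:E)%E.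
Proof.
have ci y : {in growing_itv n, continuous (gammai y)}.
  by move=> t /set_mem /growing_itv_gt0 /gammai_continuous; apply.
have ii y : leb.-integrable (growing_itv n) (EFin \o gammai y).
  by apply: continuous_integrable_itv => t tn; apply: ci; apply/mem_set.
have le : n.+1%:R^-1 <= n.+1%:R :> R.
  by apply: (@le_trans _ _ 1); rewrite ?invf_le1 ?ler1n.
have := @FTC2 _ _ _ _ _ le (fun t tn => derive_gammai x (growing_itv_gt0 tn)).
move=> <-; last first.
  move=> t /growing_itv_gt0 t0; apply: cvgB; last exact: gammai_continuous.
  by apply: cvgM; [exact: cvg_cst|exact: gammai_continuous].
under [X in (_ - X)%E]eq_integral do rewrite EFinB EFinM.
rewrite integralB//; last 2 first.
- by apply: integrableZl; [exact: measurable_itv|exact: ii].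
- exact: ii.
rewrite integralZl; [|exact: measurable_itv|exact: ii].
have fin y : exists u, (\int[leb]_(t in growing_itv n) (gammai y t)%:E = u%:E)%E.
  eexists; apply/esym/fineK/integrable_fin_num; first exact: measurable_itv.
  exact: ii.
move: (fin x) (fin (x + 1)) => -[u eu] [v ev].
rewrite -[`[_, _]%classic]/(growing_itv n) eu ev.
by congr EFin; rewrite /=; ring.
Qed.

(** Raise 1 + t <= p + t = p (1 + t / p) <= p exp (t / p) to the power p. *)
Lemma powR_le_expR (p t : R) : 1 <= p -> 0 <= t ->
  (1 + t) `^ p <= p `^ p * expR t.
Proof.
move=> p1 t0; have p0 : 0 < p by apply: lt_le_trans p1.
have le1 : 1 + t <= p * expR (t / p).
  apply: (@le_trans _ _ (p * (1 + t / p))).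
    by rewrite mulrDr mulr1 mulrCA divff ?gt_eqF// mulr1 lerD2r.
  by rewrite ler_wpM2l ?(ltW p0)// expR_ge1Dx.
have /(_ (addr_ge0 ler01 t0)) := ge0_ler_powR (ltW p0) _ _ le1.
move=> /(_ (ltW (mulr_gt0 p0 (expR_gt0 _)))).
by rewrite (powRM _ (ltW p0) (expR_ge0 _)) -expRM mulfVK ?gt_eqF.
Qed.

(* The last factor is the derivative of [(t / (1 + t)) `^ x], which increases from
   [0] to [1] on the half-line. *)
Lemma gammai_le x t : 0 < x -> 0 < t ->
  gammai x t <= (x + 1) `^ (x + 1) / x *
    (x * (t / (1 + t)) `^ (x - 1) * ((1 + t) ^- 2)).
Proof.
move=> x0 t0; have x1 : 0 < x + 1 by rewrite addr_gt0.
have t1 : 0 < 1 + t by rewrite addr_gt0.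
have -> : (t / (1 + t)) `^ (x - 1) = t `^ (x - 1) * (1 + t) `^ (1 - x).
  rewrite powRM ?invr_ge0 ?ltW// -powR_inv1 ?ltW// -powRrM mulN1r opprB//.
have -> : (1 + t) ^- 2 = (1 + t) `^ (- 2%:R) by rewrite powR_invn ?ltW.
rewrite /gammai.
have -> : (x + 1) `^ (x + 1) / x * (x * (t `^ (x - 1) * (1 + t) `^ (1 - x)) *
   (1 + t) `^ (- 2%:R)) = t `^ (x - 1) * ((x + 1) `^ (x + 1) *
   ((1 + t) `^ (1 - x) * (1 + t) `^ (- 2%:R))) by field; rewrite gt_eqF.
rewrite ler_wpM2l ?powR_ge0// -powRD; last by rewrite (gt_eqF t1) implybT.
have -> : 1 - x - 2%:R = - (x + 1) by ring.
rewrite powRN -ler_pdivrMl ?powR_gt0//.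
rewrite expRN -invfM lef_pV2 ?posrE ?mulr_gt0 ?powR_gt0 ?expR_gt0//.
by apply: powR_le_expR; rewrite ?(ltW t0)// lerDr ltW.
Qed.

Lemma derive_homography_powR x t : 0 < t ->
  is_derive t 1 (fun t => (t / (1 + t)) `^ x)
    (x * (t / (1 + t)) `^ (x - 1) * (1 + t) ^- 2).
Proof.
move=> t0; have t1 : 1 + t != 0 by rewrite gt_eqF// addr_gt0.
have tt : 0 < t / (1 + t) by rewrite divr_gt0 ?addr_gt0.
have d1 : is_derive t 1 (fun t : R => t / (1 + t)) ((1 + t) ^- 2).
  have ? := @is_deriveV _ (fun t : R => 1 + t) t 1 (0 + 1) t1 _.
  apply: is_derive_eq.
  by rewrite /GRing.scale/=; field.
have d2 := is_derive1_powR x tt.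
have := @is_derive1_comp _ (fun t => t `^ x) (fun t : R => t / (1 + t)) t _ _ d2 d1.
by rewrite /comp.
Qed.

(** The majorant of [gammai_le] is the derivative of a function with values in [0, C], so its
    integrals over the compact pieces are at most C, uniformly in n. *)
Lemma gammae_lty x : 0 < x -> (gammae x < +oo)%E.
Proof.
move=> x0; pose C := (x + 1) `^ (x + 1) / x.
have C0 : 0 < C by rewrite divr_gt0 ?powR_gt0 ?addr_gt0.
suff : (gammae x <= C%:E)%E by move/le_lt_trans; apply; exact: ltry.
have /cvg_lim <- // := @growing_integral_cvg x.
apply: lime_le; first by apply/cvg_ex; eexists; exact: growing_integral_cvg.
near=> n.
have le : n.+1%:R^-1 <= n.+1%:R :> R.
  by apply: (@le_trans _ _ 1); rewrite ?invf_le1 ?ler1n.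
pose F (t : R) := C * (t / (1 + t)) `^ x.
pose f (t : R) := C * (x * (t / (1 + t)) `^ (x - 1) * (1 + t) ^- 2).
have dF t : t \in `[n.+1%:R^-1, n.+1%:R] -> is_derive t 1 F (f t).
  move=> /growing_itv_gt0 t0; have ? := derive_homography_powR x t0.
  rewrite /F; apply: is_derive_eq.
  by rewrite /f /GRing.scale/=; ring.
have cf : {in `[n.+1%:R^-1, n.+1%:R], continuous f}.
  move=> t /growing_itv_gt0 t0.
  have t1 : 0 < 1 + t by rewrite addr_gt0.
  have c1 : {for t, continuous (fun t : R => 1 + t)}.
    by apply: cvgD; [exact: cvg_cst|exact: cvg_id].
  have c2 : {for t, continuous (fun t : R => (1 + t)^-1)}.
    by apply: continuousV => //; rewrite gt_eqF.
  apply: cvgM; first exact: cvg_cst.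
  apply: cvgM; last first.
    by apply: cvgV; [rewrite gt_eqF ?exprn_gt0|exact: cvgM].
  apply: cvgM; first exact: cvg_cst.
  apply: (@continuous_comp _ _ _ (fun t : R => t / (1 + t)) (fun s => s `^ (x - 1))).
    by apply: cvgM => //; exact: cvg_id.
  by apply: powR_continuous_at; rewrite divr_gt0.
apply: (@le_trans _ _ (\int[leb]_(t in growing_itv n) (f t)%:E)%E).
  apply: ge0_le_integral => //.
  - exact: measurable_itv.
  - by move=> t _; rewrite lee_fin gammai_ge0.
  - apply: (measurable_int leb); apply: (@continuous_integrable_itv _ (gammai x)).
    by move=> t /growing_itv_gt0/gammai_continuous; exact.
  - by apply: (measurable_int leb); exact: (@continuous_integrable_itv _ f).
  - by move=> t /growing_itv_gt0 t0; rewrite lee_fin gammai_le.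
rewrite (FTC2 le dF cf) lee_fin.
have Fge0 t : 0 <= F t by apply: mulr_ge0; [exact: ltW|exact: powR_ge0].
apply: (@le_trans _ _ (F n.+1%:R)); first by rewrite lerBlDr lerDl.
have p0 : 0 < n.+1%:R / (1 + n.+1%:R) :> R by rewrite divr_gt0 ?addr_gt0.
rewrite -[leRHS]mulr1 ler_wpM2l ?(ltW C0)// -(one_powR x).
rewrite ge0_ler_powR ?nnegrE ?(ltW x0) ?(ltW p0)//.
by rewrite ler_pdivrMr ?addr_gt0// mul1r lerDr.
Unshelve. all: by end_near.
Qed.

Lemma GammaE x : Gamma x = fine (gammae x).
Proof. by []. Qed.

Lemma gammae_ge0 x : (0 <= gammae x)%E.
Proof. by apply: integral_ge0 => t _; rewrite lee_fin gammai_ge0. Qed.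

Lemma EFin_Gamma x : 0 < x -> ((Gamma x)%:E = gammae x)%E.
Proof.
by move=> x0; rewrite GammaE fineK// ge0_fin_numE ?gammae_ge0 ?gammae_lty.
Qed.

Lemma Gamma_gt0 x : 0 < x -> 0 < Gamma x.
Proof.
move=> x0; rewrite -lte_fin EFin_Gamma//.
(* A lower bound of the integrand on [1, 2]: t^(x - 1) is smallest at 1 or at 2 according to the
   sign of x - 1. *)
pose c : R := Num.min 1 (2 `^ (x - 1)) * expR (- 2).
have c0 : 0 < c by rewrite mulr_gt0 ?expR_gt0// lt_min ltr01 powR_gt0.
have le : (\int[leb]_(t in `[1%R, 2%R]) c%:E <= gammae x)%E.
  apply: (@le_trans _ _ (\int[leb]_(t in `[1%R, 2%R]) (gammai x t)%:E)%E).
    apply: ge0_le_integral => //.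
    - by move=> t _; rewrite lee_fin ltW.
    - apply: (measurable_int leb); apply: (@continuous_integrable_itv _ (gammai x)).
      move=> t; rewrite in_itv/= => /andP[t1 _].
      by apply: gammai_continuous; apply: lt_le_trans t1.
    - move=> t; rewrite /= in_itv/= lee_fin => /andP[t1 t2].
      rewrite ler_pM ?le_min ?ler01 ?powR_ge0 ?expR_ge0//; last first.
        by rewrite ler_expR lerN2.
      have [x1|x1] := leP 0 (x - 1).
        by rewrite ge_min -[X in X <= _](one_powR (x - 1)) ge0_ler_powR ?nnegrE ?(le_trans _ t1).
      rewrite ge_min; apply/orP; right.
      rewrite -[x - 1]opprK !(powRN _ (- (x - 1))) lef_pV2 ?posrE ?powR_gt0 ?(lt_le_trans _ t1)//.
      by rewrite ge0_ler_powR ?nnegrE ?oppr_ge0 ?(ltW x1) ?(le_trans _ t1).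
  apply: ge0_subset_integral => //.
  - apply/measurable_EFinP; apply: open_continuous_measurable_fun.
      exact: interval_open.
    by move=> t /set_mem; rewrite /= in_itv/= andbT => /gammai_continuous; exact.
  - by move=> t _; rewrite lee_fin gammai_ge0.
  - by move=> t; rewrite /= !in_itv/= andbT => /andP[t1 _]; apply: lt_le_trans t1.
apply: lt_le_trans le.
rewrite integral_cst//= lebesgue_measure_itv/= lte_fin ltr1n/= -EFinB -EFinM lte_fin.
by rewrite mulr_gt0// subr_gt0 ltr1n.
Qed.

Lemma GammaD1 x : 0 < x -> Gamma (x + 1) = x * Gamma x.
Proof.
move=> x0; apply: EFin_inj; rewrite EFinM !EFin_Gamma ?addr_gt0//.
have c1 := @growing_integral_cvg (x + 1).
have c2 : (\int[leb]_(t in growing_itv n) (gammai (x + 1) t)%:E @[n --> \oo] -->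
           x%:E * gammae x - 0)%E.
  under eq_cvg do rewrite growing_integral_gammai.
  apply: cvgeB; first by rewrite fin_num_adde_defl.
    by apply: cvgeZl => //; exact: growing_integral_cvg.
  apply: cvg_EFin; first by near=> n.
  rewrite -(subr0 0); apply: cvgB => /=.
  (* At infinity: [powR_le_expR] with the exponent x + 1 leaves a spare factor 1 / (n + 1). *)
  + have x1 : 1 <= x + 1 by rewrite lerDr ltW.
    have b0 n : 0 <= n.+1%:R `^ x * expR (- n.+1%:R) <=
        (x + 1) `^ (x + 1) * harmonic n.
      rewrite mulr_ge0 ?powR_ge0 ?expR_ge0//=.
      have n1 : 0 < 1 + n.+1%:R :> R by rewrite addr_gt0.
      have := powR_le_expR x1 (ler0n R n.+1).
      rewrite -(ler_pM2r (expR_gt0 (- n.+1%:R))) -mulrA -expRD subrr expR0 mulr1.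
      rewrite -(ler_pM2r (_ : 0 < n.+1%:R^-1)) ?invr_gt0// /harmonic.
      apply: le_trans.
      rewrite mulrAC ler_wpM2r ?expR_ge0//.
      rewrite ler_pdivlMr//.
      rewrite mulrC -[X in _ * _ `^ X](addrK 1 x) mulr_powRB1 ?addr_gt0//.
      by rewrite ge0_ler_powR ?nnegrE ?addr_ge0 ?(ltW x0)// lerDr.
    apply: (squeeze_cvgr (f := fun=> 0) _ (cvg_cst _)).
      by near=> n; exact: b0.
    by rewrite -(mulr0 ((x + 1) `^ (x + 1))); apply: cvgM; [exact: cvg_cst|exact: cvg_harmonic].
  (* At 0: the exponential is at most 1, and (1 / (n + 1))^x tends to 0 because x > 0. *)
  + apply: (squeeze_cvgr (f := fun=> 0) (h := fun n => n.+1%:R^-1 `^ x) _ (cvg_cst _)).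
      near=> n; rewrite mulr_ge0 ?powR_ge0 ?expR_ge0//=.
      by rewrite -[leRHS]mulr1 ler_wpM2l ?powR_ge0// -expR0 ler_expR oppr_le0 invr_ge0.
    have hr : n.+1%:R^-1 @[n --> \oo] --> (0 : R)^'+.
      move=> A hA; have := @cvg_harmonic R _ hA.
      apply: (@filterS _ _ _ (fun n => 0 < n.+1%:R^-1 -> A n.+1%:R^-1)).
      by move=> n; apply; rewrite invr_gt0.
    exact: (cvg_comp _ _ hr (powR_cvg0 x0)).
by rewrite -(cvg_lim _ c1)// (cvg_lim _ c2)// sube0.
Unshelve. all: by end_near.
Qed.

End gamma.

(** * Power series and Bessel's equation *)

Section pseries_fact.
Context {R : realType}.
Implicit Types (c : R^nat) (x w : R).

(** This class of coefficients is stable under [pseries_diffs] and forces convergence everywhere by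
    comparison with exp, so termwise differentiation can be repeated on the whole line. *)
Definition fact_bounded c := forall m, `|c m| <= m`!%:R^-1.

Lemma fact_bounded_diffs c : fact_bounded c -> fact_bounded (pseries_diffs c).
Proof.
move=> hc m; rewrite /pseries_diffs normrM ger0_norm//.
rewrite mulrC -ler_pdivlMr// -invfM -natrM mulnC -factS; exact: hc.
Qed.

Lemma cvg_fact_bounded c x : fact_bounded c -> cvgn (pseries c x).
Proof.
move=> hc; apply: normed_cvg.
apply: (@series_le_cvg _ _ (exp_coeff `|x|)).
- by move=> n /=.
- by move=> n; rewrite /exp_coeff/= divr_ge0// exprn_ge0.
- move=> n /=; rewrite normrM normrX /exp_coeff/= mulrC.
  by rewrite ler_wpM2l ?exprn_ge0.
exact: is_cvg_series_exp_coeff.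
Qed.

Definition psum c x : R := limn (pseries c x).

Lemma is_derive_psum c x : fact_bounded c ->
  is_derive x 1 (psum c) (psum (pseries_diffs c) x).
Proof.
move=> hc; apply: (@pseries_snd_diffs _ c (`|x| + 1)).
- exact: cvg_fact_bounded.
- by apply: cvg_fact_bounded; exact: fact_bounded_diffs.
- by apply: cvg_fact_bounded; do 2 apply: fact_bounded_diffs.
- by apply: lt_le_trans (ler_norm _); rewrite ltrDl.
Qed.

Lemma psum0 c : psum c 0 = c 0.
Proof.
apply/cvg_lim => //; rewrite -(cvg_shiftn 1)/=.
apply: cvg_near_cst; near=> n.
rewrite /pseries/series/= addn1 big_nat_recl//= expr0 mulr1 big1 ?addr0// => i _.
by rewrite expr0n mulr0.
Unshelve. all: by end_near.
Qed.

End pseries_fact.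

Section bessel_series.
Context {R : realType}.
Variable alpha : R.
Hypothesis halpha : - (1 / 2) <= alpha.
Implicit Types (z w : R).

(** Coefficients of the normalized Bessel function as a power series in w = z^2; the power of 4
    comes from (z / 2)^(2 m). *)
Definition bessel_coef (m : nat) : R :=
  (-1) ^+ m * Gamma (alpha + 1) / (m`!%:R * Gamma (m%:R + alpha + 1)) / 4 ^+ m.

Lemma alphaD1_gt0 : 0 < alpha + 1.
Proof. by move: halpha => ?; lra. Qed.

Lemma bessel_coef0 : bessel_coef 0 = 1.
Proof.
rewrite /bessel_coef fact0 !expr0 add0r !mul1r invr1 mulr1.
by rewrite mulfV// gt_eqF// Gamma_gt0// alphaD1_gt0.
Qed.

Lemma bessel_gamma_arg_gt0 m : 0 < m%:R + alpha + 1.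
Proof.
have : 0 <= m%:R :> R by [].
by move: (m%:R : R) halpha => u ha u0; lra.
Qed.

Lemma bessel_coefS m :
  bessel_coef m.+1 = - bessel_coef m / (4 * m.+1%:R * (m%:R + alpha + 1)).
Proof.
have g0 := bessel_gamma_arg_gt0 m.
rewrite /bessel_coef factS natrM !exprS -(@natr1 _ m) (addrAC _ 1 alpha) (GammaD1 g0).
have G0 := Gamma_gt0 g0.
have f0 : m`!%:R != 0 :> R by rewrite pnatr_eq0 -lt0n fact_gt0.
have p0 : (4 : R) ^+ m != 0 by rewrite expf_neq0.
have m0 : (m%:R + 1 : R) != 0 by rewrite natr1.
move: (Gamma (m%:R + _ + _)) (Gamma (alpha + 1)) (4 ^+ m) p0 (m`!%:R) f0 G0 m0 g0.
move: (m%:R : R) ((-1) ^+ m : R) => u v G G' p p0 f f0 G0 u0 g0.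
by field; rewrite f0 (gt_eqF G0) (gt_eqF g0) p0 u0.
Qed.

(** In [bessel_coefS] the denominator is at least m + 1 in size, since 4 (m + alpha + 1) >= 1 for
    alpha >= - 1/2. *)
Lemma bessel_coef_fact_bounded : fact_bounded bessel_coef.
Proof.
elim=> [|m IH].
  by rewrite bessel_coef0 normr1 fact0 invr1.
have m0 := ler0n R m.
have g0 := bessel_gamma_arg_gt0 m.
rewrite bessel_coefS normrM normrN normfV factS natrM invfM mulrC.
rewrite ler_pM// lef_pV2 ?posrE//; last first.
  by rewrite normr_gt0 !mulf_neq0// gt_eqF.
rewrite ger0_norm ?mulr_ge0 ?(ltW g0)//.
rewrite -[leLHS]mulr1 (mulrC 4) -mulrA ler_wpM2l//.
by move: (m%:R : R) m0 halpha => u u0 ha; lra.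
Qed.

Definition bessel_h := psum bessel_coef.
Definition bessel_h1 := psum (pseries_diffs bessel_coef).
Definition bessel_h2 := psum (pseries_diffs (pseries_diffs bessel_coef)).

(** Bessel's equation in the variable w = z^2. The recurrence [bessel_coefS] makes a suitably
    truncated combination vanish exactly for every n. *)
Lemma bessel_h_ode w :
  4 * w * bessel_h2 w + 4 * (alpha + 1) * bessel_h1 w + bessel_h w = 0.
Proof.
have b0 := bessel_coef_fact_bounded.
have b1 := fact_bounded_diffs b0.
have b2 := fact_bounded_diffs b1.
have c0 := cvg_fact_bounded (x := w) b0.
have c1 := cvg_fact_bounded (x := w) b1.
have c2 := cvg_fact_bounded (x := w) b2.
(* The factor w raises the degree of the first sum by one; truncating the two others one term later
   makes all three stop at degree n. *)
pose s n : R := 4 * w * pseries (pseries_diffs (pseries_diffs bessel_coef)) w n +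
  4 * (alpha + 1) * pseries (pseries_diffs bessel_coef) w n.+1 +
  pseries bessel_coef w n.+1.
have s0 n : s n = 0.
  have pS c k : pseries c w k.+1 = pseries c w k + c k * w ^+ k.
    by rewrite /pseries seriesSr.
  elim: n => [|n]; rewrite /s.
    rewrite !pS /pseries /series/= !big_geq// /pseries_diffs bessel_coefS.
    by rewrite add0r !expr0; field; rewrite gt_eqF ?alphaD1_gt0.
  set d := @pseries_diffs R; set c := bessel_coef.
  rewrite (pS (d (d c)) n) (pS c n.+1) (pS (d c) n.+1).
  have -> : d (d c) n = n.+1%:R * (n.+2%:R * c n.+2) by [].
  have -> : d c n.+1 = n.+2%:R * c n.+2 by [].
  have g0 := bessel_gamma_arg_gt0 n.+1; move: g0; rewrite [c n.+2]bessel_coefS.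
  rewrite -(@natr1 _ n.+1) exprS -/c; move: (n.+1%:R : R) (ler0n R n.+1) => u u0 g0.
  move: (pseries (d (d c)) w n) (pseries (d c) w n.+1) (pseries c w n.+1).
  move=> S2 S1 S0 IH.
  rewrite -[RHS]IH.
  field.
  rewrite (gt_eqF g0)/=.
  by rewrite gt_eqF// ltr_wpDl.
have : s n @[n --> \oo] -->
   4 * w * bessel_h2 w + 4 * (alpha + 1) * bessel_h1 w + bessel_h w.
  apply: cvgD; first apply: cvgD.
  - by apply: cvgM; [exact: cvg_cst|].
  - by apply: cvgM; [exact: cvg_cst|rewrite (cvg_shiftS (pseries (pseries_diffs bessel_coef) w))].
  - by rewrite (cvg_shiftS (pseries bessel_coef w)).
under eq_cvg do rewrite s0.
by move/cvg_lim => <- //; apply: lim_cst.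
Qed.

(** The digits in [besselj1] and [besselj2] count derivatives of [ebesselj], computed by the chain
    rule; they are not orders of Bessel functions. *)
Definition besselj1 z : R := 2 * z * bessel_h1 (z ^+ 2).
Definition besselj2 z : R := 2 * bessel_h1 (z ^+ 2) + 4 * z ^+ 2 * bessel_h2 (z ^+ 2).

(* Unlike [besselj], this is the even entire function for negative [z] as well. *)
Definition ebesselj z : R := bessel_h (z ^+ 2).

(** Since (z / 2)^(2 m + alpha) = (z / 2)^alpha (z^2)^m / 4^m, the series of [besselJ] is the power
    series in z^2 divided by the normalizing prefactor [k]. *)
Lemma besseljE z : 0 <= z -> besselj alpha z = ebesselj z.
Proof.
rewrite le_eqVlt => /predU1P[<-|z0].
  by rewrite /besselj eqxx /ebesselj expr0n/= /bessel_h psum0 bessel_coef0.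
rewrite /besselj gt_eqF//.
have G0 := Gamma_gt0 alphaD1_gt0.
have z20 : 0 < z / 2 by rewrite divr_gt0.
set k := Gamma (alpha + 1) * _.
have k0 : k != 0 by rewrite mulf_neq0 ?gt_eqF ?powR_gt0.
rewrite /besselJ (_ : series _ = (fun n => k^-1 * pseries bessel_coef (z ^+ 2) n)).
  have c0 := cvg_fact_bounded (x := z ^+ 2) bessel_coef_fact_bounded.
  have c1 : k^-1 * pseries bessel_coef (z ^+ 2) n @[n --> \oo] --> k^-1 * ebesselj z.
    by apply: cvgM; [exact: cvg_cst|exact: c0].
  by rewrite (cvg_lim _ c1)// mulVKf.
apply/funext => n.
rewrite /pseries/series/= big_distrr/=; apply: eq_bigr => m _.
rewrite powRD; last by rewrite (gt_eqF z20) implybT.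
rewrite -natrM powR_mulrn ?(ltW z20)// /k powRN exprM expr_div_n.
have Gm := Gamma_gt0 (bessel_gamma_arg_gt0 m).
have f0 : m`!%:R != 0 :> R by rewrite pnatr_eq0 -lt0n fact_gt0.
rewrite /bessel_coef expr_div_n.
have -> : 2 ^+ 2 = 4 :> R by rewrite -natrX.
have p0 : (4 : R) ^+ m != 0 by rewrite expf_neq0.
have q0 : (z / 2) `^ alpha != 0 by rewrite gt_eqF ?powR_gt0.
move: (Gamma (m%:R + _ + _)) (Gamma (alpha + 1)) (4 ^+ m) ((z / 2) `^ alpha)
  p0 q0 (m`!%:R) f0 G0 Gm {k k0}.
move: (m%:R : R) ((-1) ^+ m : R) => u v G G' p q p0 q0 f f0 G0 Gm.
by field; rewrite f0 (gt_eqF G0) (gt_eqF Gm) p0 q0.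
Qed.

Lemma ebesselj0 : ebesselj 0 = 1.
Proof. by rewrite /ebesselj expr0n/= /bessel_h psum0 bessel_coef0. Qed.

Lemma besselj10 : besselj1 0 = 0.
Proof. by rewrite /besselj1 mulr0 mul0r. Qed.

Lemma is_derive_psum_sqr c z : fact_bounded c ->
  is_derive z 1 (fun z => psum c (z ^+ 2)) (2 * z * psum (pseries_diffs c) (z ^+ 2)).
Proof.
move=> hc; have d2 := is_derive_psum (z ^+ 2) hc.
have d1 : is_derive z 1 (fun z : R => z ^+ 2) (2 * z).
  by apply: is_derive_eq; rewrite /GRing.scale/=; ring.
have := @is_derive1_comp _ (psum c) (fun z : R => z ^+ 2) z _ _ d2 d1.
by rewrite mulrC.
Qed.

Lemma is_derive_ebesselj z : is_derive z 1 ebesselj (besselj1 z).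
Proof. exact/is_derive_psum_sqr/bessel_coef_fact_bounded. Qed.

Lemma is_derive_besselj1 z : is_derive z 1 besselj1 (besselj2 z).
Proof.
have d := is_derive_psum_sqr z (fact_bounded_diffs bessel_coef_fact_bounded).
by apply: is_derive_eq; rewrite /besselj2 /GRing.scale/= /bessel_h2; ring.
Qed.

(** Obtained by multiplying [bessel_h_ode] at z^2 by z. Without division by z the equation also
    makes sense at 0. *)
Lemma bessel_ode z :
  z * besselj2 z + (2 * alpha + 1) * besselj1 z + z * ebesselj z = 0.
Proof.
rewrite /besselj1 /besselj2 /ebesselj.
have := bessel_h_ode (z ^+ 2).
by move: (bessel_h _) (bessel_h1 _) (bessel_h2 _) => h h1 h2 /(congr1 ( *%R z)); rewrite mulr0 => <-; ring.
Qed.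



(** For z > 0 the equation gives (j^2 + j'^2)' = - 2 (2 alpha + 1) j'^2 / z <= 0, and this energy
    equals 1 at 0. *)
Lemma ebesselj_le1 z : 0 <= z -> `|ebesselj z| <= 1.
Proof.
move=> z0; pose F z := - (ebesselj z ^+ 2 + besselj1 z ^+ 2).
pose f z := - (2 * besselj1 z * (ebesselj z + besselj2 z)).
have dF x : x \in `[0, z] -> is_derive x 1 F (f x).
  move=> _; have ? := is_derive_ebesselj x; have ? := is_derive_besselj1 x.
  by apply: is_derive_eq; rewrite /f /GRing.scale/=; ring.
have f0 x : x \in `[0, z] -> 0 <= f x.
  rewrite in_itv/= le_eqVlt => /andP[/predU1P[<- _|x0 _]].
    by rewrite /f besselj10 mulr0 mul0r oppr0.
  rewrite -(pmulr_rge0 _ x0).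
  have -> : x * f x = 2 * (2 * alpha + 1) * besselj1 x ^+ 2.
    have := bessel_ode x; rewrite /f.
    move: (besselj1 x) (besselj2 x) (ebesselj x) => a b c e.
    transitivity (2 * (2 * alpha + 1) * a ^+ 2 -
      2 * a * (x * b + (2 * alpha + 1) * a + x * c)); first by ring.
    by rewrite e mulr0 subr0.
  by rewrite mulr_ge0 ?sqr_ge0//; move: halpha => ?; lra.
have := le_itv_of_derive z0 dF f0.
rewrite /F ebesselj0 besselj10 expr0n addr0 expr1n lerN2 => h.
by rewrite -(expr_le1 (n := 2))// real_normK ?num_real// (le_trans _ h)// lerDl sqr_ge0.
Qed.
End bessel_series.

(** * Decay of the Bessel function and its derivative *)

Section bessel_decay.
Context {R : realType}.
Variable alpha : R.
Hypothesis halpha : - (1 / 2) <= alpha.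
Implicit Types (z w : R).

Lemma is_derive_powR (p z : R) : 0 < z ->
  is_derive z 1 ((fun s => s `^ p) : R -> R) (p * (z `^ p / z)).
Proof.
move=> z0; have d := is_derive1_powR p z0; apply: is_derive_eq.
by rewrite powRB ?powRr1 ?(ltW z0)// (gt_eqF z0) implybT.
Qed.

Let p : R := alpha + 1 / 2.
(** The power p is the one that removes the first-order term of Bessel's equation: [du1] shows that
    u is a harmonic oscillator perturbed by p (p - 1) u / z^2. *)
Let u z := z `^ p * ebesselj alpha z.
Let u1 z := z `^ p * (p / z * ebesselj alpha z + besselj1 alpha z).

Let du z : 0 < z -> is_derive z 1 u (u1 z).
Proof.
move=> z0; have ? := is_derive_powR p z0; have ? := is_derive_ebesselj halpha z.
by apply: is_derive_eq; rewrite /u1 /GRing.scale/=; ring.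
Qed.

Let du1 z : 0 < z -> is_derive z 1 u1 ((p * (p - 1) / z ^+ 2 - 1) * u z).
Proof.
move=> z0; have ? := is_derive_powR p z0; have ? := is_derive_ebesselj halpha z.
have ? := is_derive_besselj1 halpha z.
have ? := @is_deriveV _ (fun z : R => z) z 1 _ (lt0r_neq0 z0) (is_derive_id _ _).
apply: is_derive_eq; rewrite /u /GRing.scale/=.
have := bessel_ode halpha z.
move: (z `^ p) (besselj1 alpha z) (besselj2 alpha z) (ebesselj alpha z) => Z a b c e.
have -> : b = - (2 * alpha + 1) / z * a - c.
  apply: (mulfI (lt0r_neq0 z0)).
  rewrite -[LHS]subr0 -e. by field; rewrite gt_eqF.
by rewrite /p; field; rewrite gt_eqF.
Qed.

(** The perturbation changes u^2 + u'^2 at a relative rate of at most c / z^2 with c = |p (p - 1)|.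
    The weight exp (c / z) has logarithmic derivative - c / z^2, which absorbs this change, and it
    is at least 1. *)
Let E z := (u z ^+ 2 + u1 z ^+ 2) * expR (`|p * (p - 1)| / z).

Let energy_nonincreasing z : 1 <= z -> E z <= E 1.
Proof.
move=> z1; rewrite -lerN2; set c := `|p * (p - 1)|.
have pos x : x \in `[1, z] -> 0 < x.
  by rewrite in_itv/= => /andP[x1 _]; apply: lt_le_trans x1.
apply: (@le_itv_of_derive _ (fun z => - E z) (fun z => expR (c / z) / z ^+ 2 *
  (c * (u z ^+ 2 + u1 z ^+ 2) - 2 * (p * (p - 1)) * u z * u1 z))) => // x /pos x0.
  have ? := du x0; have ? := du1 x0.
  have ? := @is_deriveV _ (fun z : R => z) x 1 _ (lt0r_neq0 x0) (is_derive_id _ _).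
  have de : is_derive x 1 (fun x => expR (c / x)) (expR (c / x) * (- c / x ^+ 2)).
    have d1 : is_derive x 1 (fun x : R => c / x) (- c / x ^+ 2).
      by apply: is_derive_eq; rewrite /GRing.scale/=; ring.
    have := @is_derive1_comp _ expR (fun x : R => c / x) x _ _ (is_derive_expR _) d1.
    by [].
  apply: is_derive_eq; rewrite /GRing.scale/= -/c.
  by field; rewrite gt_eqF.
rewrite mulr_ge0 ?divr_ge0 ?expR_ge0 ?sqr_ge0// subr_ge0.
have c1 : 0 <= c - p * (p - 1) by rewrite subr_ge0 ler_norm.
have c2 : 0 <= c + p * (p - 1) by rewrite -lerBlDr sub0r lerNl lerNnormlW.
(* Writing q = p (p - 1), the sum (c - q) (a + b)^2 + (c + q) (a - b)^2 is twice c (a^2 + b^2) - 2 q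
   a b. *)
have := mulr_ge0 c1 (sqr_ge0 (u x + u1 x)); have := mulr_ge0 c2 (sqr_ge0 (u x - u1 x)).
move: (p * (p - 1)) (c : R) (u x) (u1 x) => q' c' a b.
by rewrite -subr_ge0 => h1 h2; nra.
Qed.

Lemma bessel_decay : exists2 K : R, 0 < K & forall z, 1 <= z ->
  `|ebesselj alpha z| <= K * z `^ (- p) /\ `|besselj1 alpha z| <= K * z `^ (- p).
Proof.
pose K := E 1 + 1.
have E0 : 0 <= E 1 by rewrite mulr_ge0 ?expR_ge0// addr_ge0 ?sqr_ge0.
have p0 : 0 <= p by move: halpha => ?; rewrite /p; lra.
have K0 : 0 < K by rewrite ltr_wpDl.
exists (K * (1 + p)) => [|z z1]; first by rewrite mulr_gt0// ltr_wpDr.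
have z0 : 0 < z by apply: lt_le_trans z1.
have le2 : u z ^+ 2 + u1 z ^+ 2 <= E 1.
  apply: le_trans (energy_nonincreasing z1).
  rewrite -[leLHS]mulr1 ler_wpM2l ?addr_ge0 ?sqr_ge0//.
  by rewrite -[leLHS]expR0 ler_expR divr_ge0// ltW.
(* The crude |x| <= x^2 + 1 avoids a square root; it accounts for the + 1 in [K]. *)
have sq (x y : R) : x ^+ 2 <= y -> `|x| <= y + 1.
  rewrite -(real_normK (num_real x)); have := normr_ge0 x; move: `|x| => w.
  by move=> w0 h; have := sqr_ge0 (w - 1); rewrite sqrrB; nra.
have bu : `|u z| <= K.
  by apply: sq; apply: le_trans le2; rewrite lerDl sqr_ge0.
have bu1 : `|u1 z| <= K.
  by apply: sq; apply: le_trans le2; rewrite lerDr sqr_ge0.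
have zp0 : 0 < z `^ p by rewrite powR_gt0.
rewrite powRN; split; rewrite ler_pdivlMr// -[X in _ * X]ger0_norm ?(ltW zp0)// -normrM mulrC.
  by apply: (le_trans bu); rewrite ler_peMr ?lerDl// addr_ge0.
(* The derivative j' is recovered from u' by subtracting p u / z, where p / z <= p; hence the
   constant K (1 + p). *)
have -> : z `^ p * besselj1 alpha z = u1 z - p / z * u z.
  by rewrite /u1 /u; field; rewrite gt_eqF.
rewrite (le_trans (ler_normB _ _))// mulrDr mulr1 lerD// normrM mulrC ler_pM//.
rewrite ger0_norm ?divr_ge0// ?(ltW z0)// ler_pdivrMr// ler_peMr//.
Qed.

End bessel_decay.

Section powR_comparison.
Context {R : realType}.
Implicit Types (p t x : R).

Lemma powR_comparable (lambda p t x : R) : 1 <= lambda -> 0 < x ->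
  x / lambda <= t <= lambda * x -> t `^ p <= lambda `^ `|p| * x `^ p.
Proof.
move=> l1 x0 /andP[t1 t2]; have l0 : 0 < lambda by apply: lt_le_trans l1.
have t0 : 0 < t by apply: lt_le_trans t1; rewrite divr_gt0.
have [p0|p0] := leP 0 p.
  rewrite ger0_norm// -powRM ?(ltW l0) ?(ltW x0)//.
  by rewrite ge0_ler_powR ?nnegrE ?(ltW t0) ?mulr_ge0 ?(ltW l0) ?(ltW x0).
rewrite ltr0_norm// -[in t `^ p](opprK p) -[in x `^ p](opprK p) !(powRN _ (- p)).
rewrite ler_pdivlMr ?powR_gt0// mulrC ler_pdivrMr ?powR_gt0//.
rewrite -powRM ?(ltW l0) ?(ltW t0)// ge0_ler_powR ?nnegrE ?oppr_ge0 ?(ltW p0) ?(ltW x0)//.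
  by rewrite mulr_ge0 ?(ltW l0) ?(ltW t0).
by rewrite mulrC -ler_pdivrMr.
Qed.

End powR_comparison.

Section integral_bounds.
Context {R : realType}.
Local Notation leb := (@lebesgue_measure R).
Implicit Types (a b x y : R) (f g : R -> R).

Lemma Rintegral_FTC2 (F f : R -> R) a b : a <= b ->
  (forall x, x \in `[a, b] -> is_derive x 1 F (f x)) ->
  {in `[a, b], continuous f} ->
  \int[leb]_(x in `[a, b]) f x = F b - F a.
Proof. by move=> ab dF cf; rewrite /Rintegral (FTC2 ab dF cf). Qed.

Lemma Rintegral_le_bound f A a b : a <= b ->
  leb.-integrable `[a, b] (EFin \o f) ->
  (forall x, x \in `[a, b] -> `|f x| <= A) ->
  `|\int[leb]_(x in `[a, b]) f x| <= A * (b - a).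
Proof.
move=> ab fi fA; apply: le_trans (le_normr_Rintegral _ fi) _ => //.
apply: (@le_trans _ _ (\int[leb]_(x in `[a, b]) A)).
  apply: le_Rintegral => //.
  - exact: integrable_norm.
  - by apply: (@continuous_integrable_itv _ (fun=> A)) => x _; exact: cvg_cst.
rewrite Rintegral_cst//= lebesgue_measure_itv/= lte_fin.
case: ltP => [//|ba]; have -> : b = a by apply/eqP; rewrite eq_le ab ba.
by rewrite subrr.
Qed.

End integral_bounds.

(** * Cancellation in integrals of the kernel *)

Section bessel_oscillation.
Context {R : realType}.
Local Notation leb := (@lebesgue_measure R).
Variable alpha : R.
Hypothesis halpha : - (1 / 2) <= alpha.
Implicit Types (z w : R).

Lemma continuous_powR_comp (p r t : R) (f : R -> R) : 0 < t -> continuous f ->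
  {for t, continuous (fun t => t `^ p * f (r * t))}.
Proof.
move=> t0 cf; apply: cvgM; first exact: powR_continuous_at.
apply: (@continuous_comp _ _ _ (fun t => r * t) f); last exact: cf.
by apply: cvgM; [exact: cvg_cst|exact: cvg_id].
Qed.

Lemma is_derive_continuous (f df : R -> R) :
  (forall x : R, is_derive x (1 : R) f (df x)) -> continuous f.
Proof.
move=> d x; apply: differentiable_continuous; apply/derivable1_diffP.
exact: ex_derive.
Qed.

Lemma continuous_ebesselj : continuous (ebesselj alpha).
Proof. exact: is_derive_continuous (is_derive_ebesselj halpha). Qed.

Lemma continuous_besselj1 : continuous (besselj1 alpha).
Proof. exact: is_derive_continuous (is_derive_besselj1 halpha). Qed.

(* By Bessel's equation, [t `^ nu * j (r * t)] is, up to a term smaller by a factor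
   [r * t], the derivative of [- t `^ nu * j' (r * t) / r]. *)
Lemma bessel_oscillation (nu : R) : exists2 K : R, 0 < K &
  forall r x y, 0 < r -> 1 <= r * x -> x <= y <= 2 * x ->
  `|\int[leb]_(t in `[x, y]) (t `^ nu * ebesselj alpha (r * t))| <=
  K * (x `^ nu / r * (r * x) `^ (- (alpha + 1 / 2))).
Proof.
have [K0 K00 decay] := bessel_decay halpha.
set p := alpha + 1 / 2 in decay *.
(* Differentiating - P / r and eliminating j'' by Bessel's equation leaves g - (m / t) (P / r), that
   is, g - k. *)
pose m := nu - 2 * alpha - 1.
pose B := K0 * 2 `^ `|nu| * 2 `^ `|- p|.
have B0 : 0 < B by rewrite !mulr_gt0 ?powR_gt0.
(* The 2 counts the boundary values of P / r; |m| comes from k, which is at most |m| B M / x on an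
   interval of length at most x. *)
exists ((2 + `|m|) * B); first by rewrite mulr_gt0// ltr_wpDr.
move=> r x y r0 rx /andP[xy y2x]; set M := _ * _ `^ (- p).
have x0 : 0 < x by rewrite -(pmulr_rgt0 _ r0); apply: lt_le_trans rx.
have M0 : 0 <= M by rewrite mulr_ge0 ?divr_ge0 ?powR_ge0 ?(ltW r0).
pose P t := t `^ nu * besselj1 alpha (r * t).
have bP t : t \in `[x, y] -> `|P t / r| <= B * M.
  rewrite in_itv/= => /andP[xt ty].
  have t0 : 0 < t by apply: lt_le_trans xt.
  have t2 : x / 2 <= t <= 2 * x.
    by rewrite (le_trans ty y2x) andbT (le_trans _ xt)// ler_pdivrMr// ler_peMr ?ler1n// ltW.
  have rt2 : (r * x) / 2 <= r * t <= 2 * (r * x).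
    by rewrite -mulrA !(mulrCA 2 r) !(ler_pM2l r0).
  have rt1 : 1 <= r * t by rewrite (le_trans rx)// ler_pM2l.
  have [_ h] := decay _ rt1.
  have e1 := powR_comparable nu (ler1n R 2) x0 t2.
  have e2 := powR_comparable (- p) (ler1n R 2) (lt_le_trans ltr01 rx) rt2.
  rewrite normrM normfV (gtr0_norm r0) normrM (ger0_norm (powR_ge0 _ _)).
  have -> : B * M = ((2 `^ `|nu| * x `^ nu) * (K0 * (2 `^ `|- p| * (r * x) `^ (- p)))) / r.
    by rewrite /B /M; ring.
  rewrite ler_wpM2r ?invr_ge0 ?(ltW r0)// ler_pM ?powR_ge0//.
  by apply: (le_trans h); rewrite ler_wpM2l ?(ltW K00).
have t0 t : t \in `[x, y] -> 0 < t.
  by rewrite in_itv/= => /andP[xt _]; apply: lt_le_trans xt.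
pose g t := t `^ nu * ebesselj alpha (r * t).
pose k t := m / t * (P t / r).
have cP t : t \in `[x, y] -> {for t, continuous P}.
  by move=> /t0 h; apply: continuous_powR_comp => //; exact: continuous_besselj1.
have cg : {in `[x, y], continuous g}.
  by move=> t /t0 h; apply: continuous_powR_comp => //; exact: continuous_ebesselj.
have ck : {in `[x, y], continuous k}.
  move=> t txy; have h := t0 _ txy; apply: cvgM.
    by apply: cvgM; [exact: cvg_cst|apply: cvgV => //; rewrite gt_eqF].
  by apply: cvgM; [exact: cP|exact: cvg_cst].
have ig := continuous_integrable_itv cg; have ik := continuous_integrable_itv ck.
have e : \int[leb]_(t in `[x, y]) (g t - k t) = - (P y / r) - - (P x / r).
  apply: (@Rintegral_FTC2 _ (fun t => - (P t / r))) => // [t /t0 h|t txy]; last first.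
    by apply: cvgB; [exact: cg|exact: ck].
  have ? := is_derive_powR nu h.
  have dj : is_derive t 1 (fun t => besselj1 alpha (r * t)) (r * besselj2 alpha (r * t)).
    have d1 : is_derive t 1 (fun t => r * t) r.
      by apply: is_derive_eq; rewrite /GRing.scale/=; ring.
    have := @is_derive1_comp _ (besselj1 alpha) (fun t : R => r * t) t _ _
      (is_derive_besselj1 halpha (r * t)) d1.
    by rewrite mulrC.
  apply: is_derive_eq; rewrite /g /k /P /m /GRing.scale/=.
  have := bessel_ode halpha (r * t).
  move: (t `^ nu) (besselj1 alpha _) (besselj2 alpha _) (ebesselj alpha _) => Z a b c e.
  have -> : b = - (2 * alpha + 1) / (r * t) * a - c.
    apply: (mulfI (lt0r_neq0 (mulr_gt0 r0 h))).
    by rewrite -[LHS]subr0 -e; field; rewrite !gt_eqF.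
  by field; rewrite !gt_eqF.
have -> : \int[leb]_(t in `[x, y]) g t = - (P y / r) + P x / r + \int[leb]_(t in `[x, y]) k t.
  by rewrite -[P x / r]opprK -e RintegralB// subrK.
have -> : (2 + `|m|) * B * M = B * M + B * M + `|m| * B * M by ring.
have bk : `|\int[leb]_(t in `[x, y]) k t| <= `|m| / x * (B * M) * (y - x).
  apply: Rintegral_le_bound => // t txy; rewrite normrM ler_pM//; last exact: bP.
  rewrite normrM normfV ler_wpM2l// (gtr0_norm (t0 _ txy)) lef_pV2 ?posrE ?(t0 _ txy)//.
  by move: txy; rewrite in_itv/= => /andP[].
rewrite (le_trans (ler_normD _ _))// lerD//.
  rewrite (le_trans (ler_normD _ _))// normrN lerD// bP ?bound_itvE//.
apply: (le_trans bk).
rewrite [leLHS](_ : _ = `|m| * B * M * ((y - x) / x)); last by ring.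
rewrite ler_piMr//; first by apply: mulr_ge0 => //; rewrite mulr_ge0 ?(ltW B0).
by rewrite ler_pdivrMr// mul1r lerBlDr -mulr2n -mulr_natl.
Qed.

End bessel_oscillation.

(** * Integration against functions of bounded variation *)

Section bounded_variation_bound.
Context {R : realType}.
Local Notation leb := (@lebesgue_measure R).
Implicit Types (a b x y : R) (f g : R -> R).

Lemma integrable_subitv f a b c d : a <= c -> d <= b ->
  leb.-integrable `[a, b] (EFin \o f) -> leb.-integrable `[c, d] (EFin \o f).
Proof.
move=> ac db; apply: integrableS => //; apply: subset_itv; rewrite bnd_simp//.
Qed.

Lemma Rintegral_itv_cat f a b c : a <= c -> c <= b ->
  leb.-integrable `[a, b] (EFin \o f) ->
  \int[leb]_(x in `[a, b]) f x =
  \int[leb]_(x in `[a, c]) f x + \int[leb]_(x in `[c, b]) f x.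
Proof.
move=> ac cb fi; rewrite -(@Rintegral_itv_obnd_cbnd _ c (BRight b)); last first.
  by apply: integrableS fi => //; apply: subset_itv; rewrite bnd_simp.
by rewrite -(Rintegral_itvB fi) ?bnd_simp// addrC subrK.
Qed.

Lemma continuous_itv_bounded g a b : {in `[a, b], continuous g} ->
  exists2 B, 0 < B & forall x, x \in `[a, b] -> `|g x| <= B.
Proof.
move=> cg; have [ba|ab] := ltP b a.
  exists 1 => // x; rewrite in_itv/= => /andP[ax xb].
  by have := le_trans ax xb; rewrite leNgt ba.
have : {within `[a, b], continuous (fun x => `|g x|)}.
  apply: continuous_in_subspaceT => x /set_mem/= xab.
  by apply: (@continuous_comp _ _ _ g (fun y => `|y|)); [exact: cg|exact: norm_continuous].
move=> /(EVT_max ab)[c _ hc]; exists (`|g c| + 1); first by rewrite ltr_wpDl.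
by move=> x /hc /le_trans; apply; rewrite lerDl.
Qed.

Lemma integrable_mul_continuous f g a b :
  leb.-integrable `[a, b] (EFin \o f) -> {in `[a, b], continuous g} ->
  leb.-integrable `[a, b] (EFin \o (fun x => f x * g x)).
Proof.
move=> fi cg; have [B B0 gB] := continuous_itv_bounded cg.
rewrite (_ : EFin \o _ = ((EFin \o f) \* (EFin \o g))%E).
  apply: integrableMl => //.
    by apply/measurable_EFinP; apply: measurable_int (continuous_integrable_itv cg).
  exists B; split; first exact: num_real.
  by move=> M BM x /= xab; apply: le_trans (ltW BM); exact: gB.
by apply/funext => x /=; rewrite EFinM.
Qed.

(* Riemann-Stieltjes integration by parts against a partition of mesh [h], with
   an error [B * h] per unit of variation that vanishes in the limit. *)
Lemma Rintegral_variation_bound (u g W : R -> R) (A a b : R) : a <= b ->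
  (forall s t, a <= s -> s <= t -> t <= b -> `|u t - u s| <= W t - W s) ->
  leb.-integrable `[a, b] (EFin \o u) -> {in `[a, b], continuous g} ->
  (forall t, t \in `[a, b] -> `|\int[leb]_(x in `[a, t]) g x| <= A) ->
  `|\int[leb]_(x in `[a, b]) (u x * g x)| <= A * (`|u b| + (W b - W a)).
Proof.
move=> ab uW ui cg GA; have [B B0 gB] := continuous_itv_bounded cg.
pose G t := \int[leb]_(x in `[a, t]) g x.
have ugi := integrable_mul_continuous ui cg.
have gi := continuous_integrable_itv cg.
have aW : a \in `[a, b] by rewrite bound_itvE.
have A0 : 0 <= A by apply: le_trans (GA a aW).
(* The increment from s to t equals (u s - u t) G s plus the integral of (u x - u t) g x over
   [s, t]. Both factors u s - u t and u x - u t are at most W t - W s in size. *)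
have step s t : a <= s -> s <= t -> t <= b ->
    `|(\int[leb]_(x in `[a, t]) (u x * g x) - u t * G t) -
      (\int[leb]_(x in `[a, s]) (u x * g x) - u s * G s)| <=
    (A + B * (t - s)) * (W t - W s).
  move=> sa st tb.
  have ti := integrable_subitv (lexx a) tb.
  have si := integrable_subitv sa tb.
  rewrite /G (Rintegral_itv_cat sa st (ti _ ugi)) (Rintegral_itv_cat sa st (ti _ gi)).
  rewrite -/(G s).
  have -> : \int[leb]_(x in `[s, t]) (u x * g x) =
      \int[leb]_(x in `[s, t]) ((u x - u t) * g x) + u t * \int[leb]_(x in `[s, t]) g x.
    rewrite -RintegralZl//; last exact: si.
    rewrite -RintegralD//.
    - by apply: eq_Rintegral => x _; ring.
    - rewrite (_ : _ \o _ = (fun x => (u x * g x)%:E - (u t * g x)%:E)%E); last first.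
        by apply/funext => x /=; rewrite mulrBl.
      apply: integrableB => //; first exact: si.
      rewrite (_ : (fun _ => _) = (fun x => (u t)%:E * (g x)%:E)%E)//.
      by apply: integrableZl => //; exact: si.
    - rewrite (_ : _ \o _ = (fun x => (u t)%:E * (g x)%:E)%E)//.
      by apply: integrableZl => //; exact: si.
  rewrite [X in `|X|](_ : _ = (u s - u t) * G s + \int[leb]_(x in `[s, t]) ((u x - u t) * g x)); last by ring.
  rewrite (le_trans (ler_normD _ _))// [leRHS]mulrDl lerD//.
    rewrite normrM mulrC ler_pM//; last by rewrite distrC uW.
    by apply: GA; rewrite in_itv/= sa (le_trans st).
  have -> : B * (t - s) * (W t - W s) = ((W t - W s) * B) * (t - s) by ring.
  apply: Rintegral_le_bound => //.
    rewrite (_ : _ \o _ = (fun x => (u x * g x)%:E - (u t * g x)%:E)%E); last first.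
      by apply/funext => x /=; rewrite mulrBl.
    apply: integrableB => //; first exact: si.
    rewrite (_ : (fun _ => _) = (fun x => (u t)%:E * (g x)%:E)%E)//.
    by apply: integrableZl => //; exact: si.
  move=> x; rewrite in_itv/= => /andP[sx xt].
  rewrite normrM ler_pM//; last by rewrite gB// in_itv/= (le_trans sa sx) (le_trans xt tb).
  rewrite distrC (le_trans (uW _ _ (le_trans sa sx) xt tb))// lerD2l lerN2 -subr_ge0.
  by apply: le_trans (uW s x sa sx (le_trans xt tb)).
have V0 : 0 <= W b - W a by apply: le_trans (uW a b (lexx a) ab (lexx b)).
(* Telescoping over n + 1 equal steps of length h: the factor A + B h is common, and the increments
   of W add up to W b - W a. *)
have lim n : `|\int[leb]_(x in `[a, b]) (u x * g x) - u b * G b| <=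
    (A + B * ((b - a) / n.+1%:R)) * (W b - W a).
  set h := (b - a) / n.+1%:R.
  have h0 : 0 <= h by rewrite divr_ge0// subr_ge0.
  pose t i := a + i%:R * h.
  have tS i : t i.+1 = t i + h by rewrite /t -natr1; ring.
  have ta i : a <= t i by rewrite lerDl mulr_ge0.
  have tn : t n.+1 = b by rewrite /t /h mulrC divfK ?pnatr_eq0// addrC subrK.
  have tb i : (i <= n.+1)%N -> t i <= b.
    by move=> lin; rewrite -tn lerD2l ler_wpM2r// ler_nat.
  suff H i : (i <= n.+1)%N -> `|\int[leb]_(x in `[a, t i]) (u x * g x) - u (t i) * G (t i)| <=
      (A + B * h) * (W (t i) - W a) by rewrite -tn; exact: H.
  elim: i => [_|i IH lin].
    have -> : t 0%N = a by rewrite /t mul0r addr0.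
    by rewrite /G set_itv1 !Rintegral_set1 mulr0 !subrr normr0 mulr0.
  have tt : t i <= t i.+1 by rewrite tS lerDl.
  have := step _ _ (ta i) tt (tb _ lin).
  have -> : t i.+1 - t i = h by rewrite tS addrC addKr.
  have := IH (ltnW lin).
  rewrite (_ : W (t i.+1) - W a = (W (t i) - W a) + (W (t i.+1) - W (t i))); last by ring.
  move=> h1 h2; rewrite mulrDr; apply: le_trans (lerD h1 h2).
  by apply: le_trans (ler_normD _ _); rewrite addrCA subrr addr0.
have lim2 : `|\int[leb]_(x in `[a, b]) (u x * g x) - u b * G b| <= A * (W b - W a).
  apply/ler_addgt0Pr => e e0.
  pose q := B * (b - a) * (W b - W a).
  have q0 : 0 <= q by rewrite mulr_ge0// mulr_ge0 ?subr_ge0// ltW.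
  pose n := Num.bound (q / e).
  apply: (le_trans (lim n)).
  rewrite mulrDl lerD2l.
  rewrite [leLHS](_ : _ = q / n.+1%:R); last by rewrite /q; ring.
  rewrite ler_pdivrMr// mulrC -ler_pdivrMr//.
  apply: ltW; apply: lt_trans (archi_boundP _) _; first by rewrite divr_ge0// ltW.
  by rewrite ltr_nat.
rewrite -[X in `|X|](subrK (u b * G b)) (le_trans (ler_normD _ _))// mulrDr addrC lerD//.
rewrite normrM mulrC ler_wpM2r//.
by apply: GA; rewrite bound_itvE.
Qed.

(** Take for [W] the variation of u accumulated from a; additivity of the total variation makes its
    increments dominate those of u. *)
Lemma Rintegral_total_variation_bound (u g : R -> R) (A V a b : R) : a <= b ->
  (total_variation a b u <= V%:E)%E ->
  leb.-integrable `[a, b] (EFin \o u) -> {in `[a, b], continuous g} ->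
  (forall t, t \in `[a, b] -> `|\int[leb]_(x in `[a, t]) g x| <= A) ->
  `|\int[leb]_(x in `[a, b]) (u x * g x)| <= A * (`|u b| + V).
Proof.
move=> ab TV ui cg GA.
pose W t := fine (total_variation a t u).
have fin s t : a <= s -> s <= t -> t <= b -> total_variation s t u \is a fin_num.
  move=> sa st tb; rewrite ge0_fin_numE ?total_variation_ge0//.
  apply: (@le_lt_trans _ _ (total_variation a b u)); last first.
    by apply: le_lt_trans TV _; exact: ltry.
  rewrite (total_variationD u sa (le_trans st tb)) (total_variationD u st tb).
  rewrite addeC -addeA leeDl// adde_ge0// total_variation_ge0//.
have uW s t : a <= s -> s <= t -> t <= b -> `|u t - u s| <= W t - W s.
  move=> sa st tb; rewrite /W (total_variationD u sa st) fineD ?fin ?(le_trans st)//.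
  rewrite addrAC subrr add0r -lee_fin fineK ?fin//; exact: total_variation_ge.
apply: (le_trans (Rintegral_variation_bound ab uW ui cg GA)).
have A0 : 0 <= A by apply: le_trans (GA a _); rewrite ?bound_itvE.
rewrite ler_wpM2l// lerD2l /W total_variationxx subr0 -lee_fin fineK// fin//.
Qed.

End bounded_variation_bound.

(** * Tails of the Hankel transform *)

Section hankel_tail.
Context {R : realType}.
Local Notation leb := (@lebesgue_measure R).
Variables (alpha nu mu : R).
Hypothesis halpha : - (1 / 2) <= alpha.
Hypothesis hmunu : 0 < mu + nu < alpha + 3 / 2.
Implicit Types (r x y : R) (u : R -> R).

Lemma gt0_powRD (p q x : R) : 0 < x -> x `^ (p + q) = x `^ p * x `^ q.
Proof. by move=> x0; rewrite powRD// (gt_eqF x0) implybT. Qed.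

Lemma gt0_powRB1 (p x : R) : 0 < x -> x `^ (p - 1) = x `^ p / x.
Proof.
by move=> x0; rewrite powRB ?powRr1 ?(ltW x0)// (gt_eqF x0) implybT.
Qed.

Definition bkernel r t : R := t `^ nu * ebesselj alpha (r * t).

Lemma continuous_bkernel r t : 0 < t -> {for t, continuous (bkernel r)}.
Proof.
by move=> t0; apply: continuous_powR_comp => //; exact: continuous_ebesselj.
Qed.

(* The consequences of the GM condition and of [f(t) = o(t ^ (mu - 1))] that are
   inherited by the real and imaginary parts of [f]. *)
Definition gm_tail (D eps X0 : R) u := [/\
  forall a b, 0 < a -> leb.-integrable `[a, b] (EFin \o u),
  forall t, X0 <= t -> `|u t| <= eps * t `^ (mu - 1) &
  forall x, X0 <= x ->
    (total_variation x (2 * x)%R u <= (D * eps * x `^ (mu - 1))%:E)%E].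

(** Rate of decay of the dyadic blocks; its positivity is the upper bound in [hmunu]. *)
Let delta := alpha + 3 / 2 - (mu + nu).

(** The oscillation bound for the integrated kernel is multiplied by |u y| plus the variation, which
    is O(eps x^(mu - 1)). The remaining powers r^(mu + nu - 1) x^(mu + nu - 1) combine into a power
    of r x. *)
Lemma hankel_block D : 0 < D -> exists2 K, 0 < K &
  forall eps X0 u, 0 < X0 -> 0 < eps -> gm_tail D eps X0 u ->
  forall r x y, 0 < r -> 1 <= r * x -> X0 <= x -> x <= y <= 2 * x ->
  r `^ (mu + nu) * `|\int[leb]_(t in `[x, y]) (u t * bkernel r t)| <=
  K * eps * (r * x) `^ (- delta).
Proof.
move=> D0; have [K K0 osc] := bessel_oscillation halpha nu.
pose E := 2 `^ `|mu - 1| + D.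
have E0 : 0 < E by rewrite ltr_wpDl ?powR_ge0.
exists (K * E); first by rewrite mulr_gt0.
move=> eps X0 u X00 eps0 [ui ub uTV] r x y r0 rx xX /andP[xy y2].
have x0 : 0 < x by apply: lt_le_trans xX.
have tv : (total_variation x y u <= (D * eps * x `^ (mu - 1))%:E)%E.
  apply: le_trans (uTV x xX); rewrite (total_variationD u xy y2).
  by rewrite leeDl// total_variation_ge0.
have cg : {in `[x, y], continuous (bkernel r)}.
  by move=> t; rewrite in_itv/= => /andP[xt _]; apply: continuous_bkernel; apply: lt_le_trans xt.
have GA t : t \in `[x, y] -> `|\int[leb]_(s in `[x, t]) bkernel r s| <=
    K * (x `^ nu / r * (r * x) `^ (- (alpha + 1 / 2))).
  by rewrite in_itv/= => /andP[xt ty]; apply: osc; rewrite // xt (le_trans ty).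
have := Rintegral_total_variation_bound xy tv (ui _ _ x0) cg GA.
have uy : `|u y| <= eps * (2 `^ `|mu - 1| * x `^ (mu - 1)).
  apply: (le_trans (ub y (le_trans xX xy))); rewrite ler_wpM2l ?(ltW eps0)//.
  apply: powR_comparable => //; rewrite ?ler1n// y2 andbT (le_trans _ xy)//.
  by rewrite ler_pdivrMr// ler_peMr ?ler1n// ltW.
set A := K * _; set I := `|_|.
have A0 : 0 <= A by rewrite mulr_ge0 ?(ltW K0)// mulr_ge0 ?powR_ge0// divr_ge0 ?powR_ge0// ltW.
move=> h; have {}h : I <= A * (E * eps * x `^ (mu - 1)).
  apply: (le_trans h); rewrite ler_wpM2l//.
  rewrite [leRHS](_ : _ = eps * (2 `^ `|mu - 1| * x `^ (mu - 1)) + D * eps * x `^ (mu - 1)).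
    by rewrite lerD2r.
  by rewrite /E; ring.
apply: (le_trans (ler_wpM2l (powR_ge0 _ _) h)).
rewrite le_eqVlt; apply/orP; left; apply/eqP.
have rx0 : 0 < r * x by rewrite mulr_gt0.
have -> : - delta = - (alpha + 1 / 2) + ((mu + nu) - 1) by rewrite /delta; lra.
rewrite (gt0_powRD _ _ rx0) (gt0_powRB1 _ rx0) /A !(powRM _ (ltW r0) (ltW x0)).
rewrite (gt0_powRD mu nu x0) (gt0_powRB1 _ x0).
by field; rewrite (gt_eqF x0) (gt_eqF r0).
Qed.

Lemma hankel_dyadic D : 0 < D -> exists2 K, 0 < K &
  forall eps X0 u, 0 < X0 -> 0 < eps -> gm_tail D eps X0 u ->
  forall r x y, 0 < r -> 1 <= r * x -> X0 <= x -> x <= y ->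
  r `^ (mu + nu) * `|\int[leb]_(t in `[x, y]) (u t * bkernel r t)| <=
  K * eps * (r * x) `^ (- delta).
Proof.
move=> D0; have [K1 K10 block] := hankel_block D0.
have q1 : 2 `^ (- delta) < 1.
  have d0 : 0 < delta by move: hmunu => /andP[_ ?]; rewrite /delta subr_gt0.
  by rewrite powRN invf_lt1 ?powR_gt0// -[ltLHS](one_powR delta) gt0_ltr_powR ?nnegrE// ltr1n.
(* The sum of the geometric series of blocks, used as the solution of K = K1 + K 2^(- delta): adding
   the block [x, 2 x] to the induction hypothesis at 2 x reproduces the same constant. *)
pose K := K1 / (1 - 2 `^ (- delta)).
have q0 : 0 < 1 - 2 `^ (- delta) by rewrite subr_gt0.
exists K; first by rewrite divr_gt0.
have KE : K = K1 + K * 2 `^ (- delta).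
  by rewrite /K; move: q0; move: (2 `^ _) => q q0; field; rewrite gt_eqF.
have K1K : K1 <= K by rewrite KE lerDl mulr_ge0 ?powR_ge0// divr_ge0// ltW.
move=> eps X0 u X00 eps0 gm r x y r0 rx xX xy.
have [n yn] : exists n, y <= 2 ^+ n * x.
  have x0 : 0 < x by apply: lt_le_trans xX.
  exists (Num.bound (y / x)); rewrite -ler_pdivrMr// ltW//.
  apply: lt_le_trans (archi_boundP _) _.
    by rewrite divr_ge0 ?(ltW x0)// (le_trans _ xy)// ltW.
  by rewrite -natrX ler_nat ltnW// ltn_expl.
elim: n x yn rx xX xy => [|n IH] x yn rx xX xy.
  apply: (le_trans (block _ _ _ X00 eps0 gm r x y r0 rx xX _)).
    rewrite xy (le_trans yn)// expr0 ler_wpM2r ?ler1n//.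
    by apply: le_trans xX; exact: ltW.
  by rewrite ler_wpM2r ?powR_ge0// ler_wpM2r// ltW.
have x0 : 0 < x by apply: lt_le_trans xX.
have [y2|y2] := leP y (2 * x).
  apply: (le_trans (block _ _ _ X00 eps0 gm r x y r0 rx xX _)).
    by rewrite xy y2.
  by rewrite ler_wpM2r ?powR_ge0// ler_wpM2r// ltW.
have x2 : x <= 2 * x by rewrite ler_peMl ?(ltW x0)// ler1n.
have b1 := block _ _ _ X00 eps0 gm r x (2 * x) r0 rx xX _.
have b2 : r `^ (mu + nu) * `|\int[leb]_(t in `[2 * x, y]) (u t * bkernel r t)| <=
    K * eps * (r * (2 * x)) `^ (- delta).
  apply: IH; rewrite ?(ltW y2)//.
  - by rewrite mulrA -exprSr.
  - by apply: (le_trans rx); rewrite ler_pM2l.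
  - exact: le_trans x2.
rewrite (Rintegral_itv_cat x2 (ltW y2)); last first.
  apply: integrable_mul_continuous; first by case: gm => ui _ _; exact: ui.
  by move=> t; rewrite in_itv/= => /andP[xt _]; apply: continuous_bkernel; apply: lt_le_trans xt.
apply: (le_trans (ler_wpM2l (powR_ge0 _ _) (ler_normD _ _))).
rewrite mulrDr; apply: (le_trans (lerD (b1 _) b2)); first by rewrite x2 lexx.
rewrite [r * (2 * x)]mulrCA (powRM _ (ler0n R 2)) ?mulr_ge0 ?(ltW x0) ?(ltW r0)//.
rewrite {2}KE [leLHS](_ : _ = (K1 + K * 2 `^ (- delta)) * eps * (r * x) `^ (- delta)) ?lexx//.
by ring.
Qed.

(** The interval is cut at t = 1 / r. Below, the integrand is at most eps t^(s - 1), with primitive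
    eps t^s / s, and (r z)^s <= 1; above, [hankel_dyadic] applies. At r = 0 the prefactor vanishes
    because s > 0. *)
Lemma hankel_tail D : 0 < D -> exists2 K, 0 < K &
  forall eps X0 u, 0 < X0 -> 0 < eps -> gm_tail D eps X0 u ->
  forall r x y, 0 <= r -> X0 <= x -> x <= y ->
  r `^ (mu + nu) * `|\int[leb]_(t in `[x, y]) (u t * bkernel r t)| <= K * eps.
Proof.
move=> D0; have [K1 K10 dya] := hankel_dyadic D0.
move: hmunu => /andP[s0 s1].
have d0 : 0 < delta by rewrite /delta subr_gt0.
pose s := mu + nu.
exists (s^-1 + K1); first by rewrite addr_gt0// invr_gt0.
move=> eps X0 u X00 eps0 gm r x y.
rewrite le_eqVlt => /predU1P[<- _ _|r0 xX xy].
  rewrite powR0 ?gt_eqF// mul0r mulr_ge0 ?(ltW eps0)// addr_ge0 ?(ltW K10)//.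
  by rewrite invr_ge0 ltW.
have high z w : X0 <= z -> 1 <= r * z -> z <= w ->
    r `^ s * `|\int[leb]_(t in `[z, w]) (u t * bkernel r t)| <= K1 * eps.
  move=> zX rz zw; apply: (le_trans (dya _ _ _ X00 eps0 gm r z w r0 rz zX zw)).
  rewrite ler_piMr ?mulr_ge0 ?(ltW K10) ?(ltW eps0)// powRN invf_le1 ?powR_gt0 ?(lt_le_trans _ rz)//.
  by rewrite -[leLHS](one_powR delta) ge0_ler_powR ?nnegrE ?(ltW d0)// (le_trans _ rz).
have [rx|rx] := leP 1 (r * x).
  by apply: (le_trans (high x y xX rx xy)); rewrite ler_wpM2r ?(ltW eps0)// lerDr invr_ge0 ltW.
have x0 : 0 < x by apply: lt_le_trans xX.
have ii z : leb.-integrable `[x, z] (EFin \o (fun t => u t * bkernel r t)).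
  apply: integrable_mul_continuous; first by case: gm => ui _ _; exact: ui.
  by move=> t; rewrite in_itv/= => /andP[xt _]; apply: continuous_bkernel; apply: lt_le_trans xt.
have low z : x <= z -> r * z <= 1 ->
    r `^ s * `|\int[leb]_(t in `[x, z]) (u t * bkernel r t)| <= s^-1 * eps.
  move=> xz rz; have z0 : 0 < z by apply: lt_le_trans xz.
  have t0 t : t \in `[x, z] -> 0 < t.
    by rewrite in_itv/= => /andP[xt _]; apply: lt_le_trans xt.
  pose F t := eps / s * t `^ s.
  have cF : {in `[x, z], continuous (fun t => eps * (t `^ (s - 1)))}.
    by move=> t /t0 h; apply: cvgM; [exact: cvg_cst|exact: powR_continuous_at].
  have FE : \int[leb]_(t in `[x, z]) (eps * (t `^ (s - 1))) = F z - F x.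
    apply: Rintegral_FTC2 => // t /t0 h.
    have ? := is_derive1_powR s h.
    by apply: is_derive_eq; rewrite /GRing.scale/=; field; rewrite gt_eqF.
  have h : `|\int[leb]_(t in `[x, z]) (u t * bkernel r t)| <= F z.
    apply: (le_trans (le_normr_Rintegral _ (ii z))) => //.
    apply: (@le_trans _ _ (F z - F x)); last first.
      by rewrite lerBlDr lerDl mulr_ge0 ?powR_ge0// divr_ge0// ltW.
    rewrite -FE; apply: le_Rintegral => //.
    - exact: integrable_norm.
    - exact: continuous_integrable_itv.
    move=> t txz; have h := t0 _ txz.
    have xt : X0 <= t by move: txz; rewrite /= in_itv/= => /andP[+ _]; exact: le_trans.
    rewrite normrM /bkernel normrM (ger0_norm (powR_ge0 _ _)).
    case: gm => _ /(_ _ xt) ub _.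
    have -> : s - 1 = mu - 1 + nu by rewrite /s; ring.
    rewrite (gt0_powRD _ _ h) [leRHS]mulrA ler_pM// ?mulr_ge0 ?powR_ge0//.
    rewrite ler_piMr ?powR_ge0//; apply: ebesselj_le1 => //.
    by rewrite mulr_ge0 ?(ltW r0) ?(ltW h).
  apply: (le_trans (ler_wpM2l (powR_ge0 _ _) h)).
  rewrite /F mulrCA -powRM ?(ltW r0) ?(ltW z0)// mulrC.
  rewrite [leLHS](_ : _ = s^-1 * eps * (r * z) `^ s); last by ring.
  rewrite ler_piMr ?mulr_ge0 ?invr_ge0 ?(ltW eps0) ?(ltW s0)//.
  by rewrite -[leRHS](one_powR s) ge0_ler_powR ?nnegrE ?(ltW s0)// mulr_ge0// ltW.
have [ry|ry] := leP (r * y) 1.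
  by apply: (le_trans (low y xy ry)); rewrite ler_wpM2r ?(ltW eps0)// lerDl ltW.
have xr : x <= r^-1 by rewrite -(ler_pM2l r0) divff ?gt_eqF// ltW.
have ry' : r^-1 <= y by rewrite -(ler_pM2l r0) divff ?gt_eqF// ltW.
rewrite (Rintegral_itv_cat xr ry' (ii y)).
apply: (le_trans (ler_wpM2l (powR_ge0 _ _) (ler_normD _ _))).
rewrite mulrDr mulrDl lerD//.
  by apply: low => //; rewrite divff ?gt_eqF.
by apply: high => //; [exact: le_trans xr|rewrite divff ?gt_eqF].
Qed.

End hankel_tail.

(** * Reduction to real and imaginary parts *)

Section complex_components.
Context {R : realType}.
Local Notation leb := (@lebesgue_measure R).
Local Notation modulus := (@ComplexField.Normc.normc R).
Implicit Types (a b t : R) (f : R -> R[i]) (z : R[i]).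

Lemma normr_normc z : `|z| = (modulus z)%:C.
Proof. by case: z => a b; rewrite normc_def. Qed.

Lemma ler_Re_normc z : `|complex.Re z| <= modulus z.
Proof.
by case: z => a b /=; rewrite -sqrtr_sqr ler_wsqrtr// lerDl sqr_ge0.
Qed.

Lemma ler_Im_normc z : `|complex.Im z| <= modulus z.
Proof.
by case: z => a b /=; rewrite -sqrtr_sqr ler_wsqrtr// lerDr sqr_ge0.
Qed.

Lemma normc_ge0 z : 0 <= modulus z.
Proof. by case: z => a b /=; rewrite sqrtr_ge0. Qed.

Lemma normc_le_ReIm z : modulus z <= `|complex.Re z| + `|complex.Im z|.
Proof.
case: z => a b /=; rewrite -(@ger0_norm _ (`|a| + `|b|)) ?addr_ge0//.
rewrite -sqrtr_sqr ler_wsqrtr// sqrrD !real_normK ?num_real//.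
by rewrite -addrA lerD2l lerDr mulrn_wge0// mulr_ge0.
Qed.

Lemma ReB z w : complex.Re (z - w) = complex.Re z - complex.Re w.
Proof. by case: z; case: w. Qed.

Lemma ImB z w : complex.Im (z - w) = complex.Im z - complex.Im w.
Proof. by case: z; case: w. Qed.

Lemma Re_rcM a z : complex.Re (a%:C * z) = a * complex.Re z.
Proof. by case: z => x y /=; rewrite mul0r subr0. Qed.

Lemma Im_rcM a z : complex.Im (a%:C * z) = a * complex.Im z.
Proof. by case: z => x y /=; rewrite mul0r addr0. Qed.

(* [proj] stands for the real or the imaginary part. *)
Lemma total_variation_le_complex (proj : R[i] -> R) f a b :
  (forall z w, `|proj z - proj w| <= modulus (z - w)) ->
  (total_variation a b (proj \o f) <= ctotal_variation a b f)%E.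
Proof.
move=> le_proj; apply: ge_ereal_sup => _ [x [s ps <-] <-].
apply: (@le_trans _ _ (cvariation a b f s)%:E).
  by rewrite lee_fin; apply: ler_sum => i _; exact: le_proj.
by apply: ereal_sup_ubound; exists (cvariation a b f s) => //; exists s.
Qed.

Lemma ler_ReB_normc z w : `|complex.Re z - complex.Re w| <= modulus (z - w).
Proof. by rewrite -ReB ler_Re_normc. Qed.

Lemma ler_ImB_normc z w : `|complex.Im z - complex.Im w| <= modulus (z - w).
Proof. by rewrite -ImB ler_Im_normc. Qed.

Lemma locally_integrable_itv (u : R -> R) a b :
  locally_integrable `]0, +oo[ u -> 0 < a -> leb.-integrable `[a, b] (EFin \o u).
Proof.
move=> [mu _ iu] a0; have sub : `[a, b] `<=` `]0%R, +oo[.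
  by move=> t; rewrite /= !in_itv/= andbT => /andP[at_ _]; apply: lt_le_trans at_.
apply/integrableP; split.
  by apply/measurable_EFinP; apply: measurable_funS mu.
exact: (iu _ sub (@segment_compact _ a b)).
Qed.

Lemma measurable_normc f a b : clocally_integrable `]0, +oo[ f -> 0 < a ->
  measurable_fun `[a, b] (modulus \o f).
Proof.
move=> [fr fi] a0.
have mr := measurable_int _ (locally_integrable_itv b fr a0).
have mi := measurable_int _ (locally_integrable_itv b fi a0).
move/measurable_EFinP in mr; move/measurable_EFinP in mi.
rewrite (_ : _ \o _ = Num.sqrt \o ((fun t => complex.Re (f t) ^+ 2) \+ (fun t => complex.Im (f t) ^+ 2))).
  have ms : measurable_fun [set: R] (Num.sqrt : R -> R).
    by apply: continuous_measurable_fun; exact: sqrt_continuous.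
  apply: (measurableT_comp ms).
  by apply: measurable_funD; apply: measurable_funX.
by apply/funext => t /=; case: (f t).
Qed.

(** The bound on f is inserted into the GM integral. Starting at lambda X0 keeps the whole window
    [x / lambda, lambda x] beyond X0, and D is fixed before eps, so smallness of f passes to its
    variation. *)
Lemma GM_total_variation_le f : clocally_integrable `]0, +oo[ f -> GM f ->
  forall mu : R, exists2 D, 0 < D & exists2 lambda, 1 < lambda &
    forall eps X0, 0 < eps -> 0 < X0 ->
    (forall t, X0 <= t -> modulus (f t) <= eps * t `^ (mu - 1)) ->
    forall x, lambda * X0 <= x ->
    (ctotal_variation x (2 * x)%R f <= (D * eps * x `^ (mu - 1))%:E)%E.
Proof.
move=> fl [C [lambda [C1 l1 gm]]] mu.
have l0 : 0 < lambda by apply: lt_trans l1.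
have C0 : 0 < C by apply: lt_trans C1.
exists (C * lambda * lambda `^ `|mu - 1|); first by rewrite !mulr_gt0 ?powR_gt0.
exists lambda => // eps X0 eps0 X00 fb x xX.
have x0 : 0 < x by apply: lt_le_trans xX; rewrite mulr_gt0.
have a0 : 0 < x / lambda by rewrite divr_gt0.
have ab : x / lambda <= lambda * x.
  by apply: (@le_trans _ _ x); rewrite ?ler_pdivrMr// ?ler_peMr ?ler_peMl// ltW.
apply: (le_trans (gm x x0)).
pose M := eps * (lambda `^ `|mu - 1| * x `^ (mu - 1)).
have M0 : 0 <= M by rewrite mulr_ge0 ?(ltW eps0)// mulr_ge0 ?powR_ge0.
have le1 : (\int[leb]_(t in `[(x / lambda)%R, (lambda * x)%R]) (modulus (f t))%:E <=
    (M * (lambda * x))%:E)%E.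
  apply: (@le_trans _ _ (\int[leb]_(t in `[(x / lambda)%R, (lambda * x)%R]) M%:E)%E).
    apply: ge0_le_integral => //.
    - by move=> t _; rewrite lee_fin normc_ge0.
    - by apply/measurable_EFinP; exact: measurable_normc.
    - move=> t; rewrite /= in_itv/= lee_fin => txl.
      have Xt : X0 <= t.
        by case/andP: txl => + _; apply: le_trans; rewrite ler_pdivlMr// mulrC.
      apply: (le_trans (fb t Xt)); rewrite ler_wpM2l ?(ltW eps0)//.
      by apply: powR_comparable => //; exact: ltW.
  rewrite integral_cst//= lebesgue_measure_itv/= lte_fin.
  case: ifPn => _; last by rewrite mule0 lee_fin mulr_ge0// mulr_ge0 ?(ltW l0) ?(ltW x0).
  by rewrite -EFinB -EFinM lee_fin ler_wpM2l// lerBlDr lerDl ltW.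
have Cx0 : (0 <= (C / x)%:E)%E by rewrite lee_fin divr_ge0 ?(ltW C0) ?(ltW x0).
apply: (le_trans (lee_wpmul2l Cx0 le1)).
rewrite -EFinM lee_fin le_eqVlt; apply/orP; left; apply/eqP.
by rewrite /M; field; rewrite gt_eqF.
Qed.

End complex_components.

Section uniform_limit.
Context {R : realType}.
Local Notation leb := (@lebesgue_measure R).

Lemma integrable_setU_disjoint (A B : set R) (f : R -> \bar R) :
  measurable A -> measurable B -> [disjoint A & B] ->
  leb.-integrable A f -> leb.-integrable B f -> leb.-integrable (A `|` B) f.
Proof.
move=> mA mB AB /integrableP[mfA iA] /integrableP[mfB iB]; apply/integrableP.
have mf : measurable_fun (A `|` B) f by apply/measurable_funU.
split=> //; rewrite ge0_integral_setU//; last exact: measurableT_comp.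
exact: lte_add_pinfty.
Qed.

Lemma integrable_set1 (a : R) (f : R -> \bar R) : leb.-integrable [set a] f.
Proof.
apply: null_set_integrable => //; first exact: measurable_fun_set1.
exact: lebesgue_measure_set1.
Qed.

(** The limit is taken along integers; a real N is then compared with an integer beyond it by the
    Cauchy condition. *)
Lemma uniform_cauchy_real (Phi : R -> R -> R) (E : set R) :
  (forall e, 0 < e -> exists X, forall M N r, X <= M -> M <= N -> E r ->
     `|Phi N r - Phi M r| <= e) ->
  exists L : R -> R, forall e, 0 < e -> exists X, forall N r, X <= N -> E r ->
    `|L r - Phi N r| <= e.
Proof.
move=> cau; exists (fun r => limn (fun n => Phi n%:R r)) => e e0.
have [X hX] := cau e e0; exists X => N r XN Er.
have cv : cvgn (fun n => Phi n%:R r).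
  apply: cauchy_cvg; apply: cauchy_exP => d d0.
  have d20 : 0 < d / 2 by rewrite divr_gt0.
  have [Y hY] := cau _ d20.
  pose m := Num.bound `|Y|.
  have Ym : Y <= m%:R by apply: le_trans (ler_norm _) _; rewrite ltW// archi_boundP.
  exists (Phi m%:R r); exists m => // n /= mn.
  rewrite /ball/= distrC; apply: (@le_lt_trans _ _ (d / 2)).
    by apply: hY => //; rewrite ler_nat.
  by rewrite ltr_pdivrMr// ltr_pMr// ltr1n.
apply/ler_addgt0Pr => d d0.
move/cvgrPdist_lt: cv => /(_ _ d0) cv.
have [n] : exists n, `|limn (fun n => Phi n%:R r) - Phi n%:R r| < d /\ N <= n%:R.
  have : \forall n \near \oo, `|limn (fun n => Phi n%:R r) - Phi n%:R r| < d /\ N <= n%:R.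
    near=> n; split; first by near: n.
    by near: n; exact: nbhs_infty_ger.
  exact: filter_ex.
move=> [h1 h2].
rewrite -[X in `|X|](subrKA (Phi n%:R r)) (le_trans (ler_normD _ _))// addrC lerD//.
  by apply: hX.
exact: ltW.
Unshelve. all: by end_near.
Qed.

End uniform_limit.

Section hankel_components.
Context {R : realType}.
Local Notation leb := (@lebesgue_measure R).
Local Notation modulus := (@ComplexField.Normc.normc R).
Variables (alpha nu mu : R).
Hypothesis halpha : - (1 / 2) <= alpha.
Implicit Types (r x y N : R) (u : R -> R) (f : R -> R[i]).

Definition partial_hankel_real u N r : R :=
  r `^ (mu + nu) * \int[leb]_(t in `[0, N]) (t `^ nu * besselj alpha (r * t) * u t).

Lemma Re_partial_hankel f N r :
  complex.Re (partial_hankel alpha nu mu f N r) =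
  partial_hankel_real (fun t => complex.Re (f t)) N r.
Proof.
rewrite /partial_hankel Re_rcM; congr (_ * _).
by apply: eq_Rintegral => t _; rewrite Re_rcM.
Qed.

Lemma Im_partial_hankel f N r :
  complex.Im (partial_hankel alpha nu mu f N r) =
  partial_hankel_real (fun t => complex.Im (f t)) N r.
Proof.
rewrite /partial_hankel Im_rcM; congr (_ * _).
by apply: eq_Rintegral => t _; rewrite Im_rcM.
Qed.

Lemma partial_hankel_real_diff u : locally_integrable `]0, +oo[ u ->
  leb.-integrable `]0, 1[ (EFin \o (fun t => t `^ nu * u t)) ->
  forall M N r, 0 < M -> M <= N -> 0 <= r ->
  partial_hankel_real u N r - partial_hankel_real u M r =
  r `^ (mu + nu) * \int[leb]_(t in `[M, N]) (u t * bkernel alpha nu r t).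
Proof.
move=> lu u1 M N r M0 MN r0.
pose k t := t `^ nu * besselj alpha (r * t) * u t.
have kE (t : R) : 0 <= t -> k t = t `^ nu * u t * ebesselj alpha (r * t).
  by move=> t0; rewrite /k besseljE ?mulr_ge0// mulrAC.
have cj : continuous (fun t => ebesselj alpha (r * t)).
  move=> t; apply: (@continuous_comp _ _ _ (fun t => r * t) (ebesselj alpha)).
    by apply: cvgM; [exact: cvg_cst|exact: cvg_id].
  exact: continuous_ebesselj.
have i1 : leb.-integrable `]0, 1[ (EFin \o k).
  pose v t := t `^ nu * u t; pose w t := ebesselj alpha (r * t).
  have h : leb.-integrable `]0, 1[ ((EFin \o v) \* (EFin \o w))%E.
    apply: integrableMl => //.
      by apply: measurable_funTS; exact: continuous_measurable_fun.
    exists 1; split; first exact: num_real.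
    move=> B B1 t /=; rewrite in_itv/= => /andP[t0 _]; apply: le_trans (ltW B1).
    by apply: ebesselj_le1 => //; rewrite mulr_ge0 ?(ltW t0).
  apply: eq_integrable h => // t /set_mem; rewrite /= in_itv/= => /andP[t0 _].
  by rewrite kE ?(ltW t0)// EFinM.
have i2 a b : 0 < a -> leb.-integrable `[a, b] (EFin \o (fun t => u t * bkernel alpha nu r t)).
  move=> a0; apply: integrable_mul_continuous; first exact: locally_integrable_itv.
  by move=> t; rewrite in_itv/= => /andP[xt _]; apply: continuous_bkernel => //; apply: lt_le_trans xt.
have kE2 t : 0 <= t -> k t = u t * bkernel alpha nu r t.
  by move=> t0; rewrite kE// /bkernel; ring.
have i3 a b : 0 < a -> leb.-integrable `[a, b] (EFin \o k).
  move=> a0; apply: eq_integrable (i2 a b a0) => // t /set_mem; rewrite /= in_itv/=.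
  by move=> /andP[at_ _]; rewrite kE2// (le_trans (ltW a0)).
have ik : leb.-integrable `[0, N] (EFin \o k).
  (* N may be less than 1, so integrability is shown up to N1 and then restricted. The point 0 is
     negligible, ]0, 1[ uses the integrability of t^nu u with |j| <= 1, and [1, N1] uses local
     integrability. *)
  pose N1 := Num.max 1 N.
  have : leb.-integrable `[0, N1] (EFin \o k).
    have -> : `[0, N1]%classic = [set 0%R] `|` (`]0%R, 1%R[ `|` `[1%R, N1]).
      apply/seteqP; split=> t /=; rewrite !in_itv/=.
        move=> /andP[]; rewrite le_eqVlt => /predU1P[<-|t0] tN; first by left.
        by right; rewrite t0 tN andbT; case: (ltP t 1); [left|right].
      have N11 : 1 <= N1 by rewrite le_max lexx.
      move=> [->|[/andP[t0 t1]|/andP[t1 tN]]].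
      - by rewrite lexx (le_trans ler01).
      - by rewrite (ltW t0) (le_trans (ltW t1)).
      - by rewrite tN (le_trans ler01).
    apply: integrable_setU_disjoint => //.
    - exact: measurableU.
    - apply/disj_setPS => t /= [->]; rewrite !in_itv/= ltxx/= => -[//|/andP[]].
      by rewrite ler10.
    - exact: integrable_set1.
    - apply: integrable_setU_disjoint => //; last exact: i3.
      apply/disj_setPS => t /= []; rewrite !in_itv/= => /andP[_ t1] /andP[t2 _].
      by move: t1; rewrite ltNge t2.
  by apply: integrable_subitv => //; rewrite le_max lexx orbT.
rewrite /partial_hankel_real -mulrBr -/k; congr (_ * _).
rewrite (Rintegral_itv_cat (ltW M0) MN ik) addrAC subrr add0r.
apply: eq_Rintegral => t /set_mem; rewrite /= in_itv/= => /andP[Mt _].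
by rewrite -kE2// (le_trans (ltW M0)).
Qed.

End hankel_components.

(** * Sufficiency of the decay condition *)

Section sufficiency.
Context {R : realType}.
Local Notation leb := (@lebesgue_measure R).
Local Notation modulus := (@ComplexField.Normc.normc R).
Variables (alpha nu mu : R).
Hypothesis halpha : - (1 / 2) <= alpha.
Hypothesis hmunu : 0 < mu + nu < alpha + 3 / 2.
Variable f : R -> R[i].
Hypothesis hloc : clocally_integrable `]0, +oo[ f.
Hypothesis hGM : GM f.
Hypothesis hL1 : cintegrable `]0, 1[ (fun t => (t `^ nu)%:C * f t).

Lemma littleo_pinftyP :
  ((fun M : R => modulus (f M) : R^o) =o_+oo (fun M : R => M `^ (mu - 1) : R^o)) <->
  (forall eps, 0 < eps -> exists2 X0, 0 < X0 &
    forall t, X0 <= t -> modulus (f t) <= eps * t `^ (mu - 1)).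
Proof.
split=> [/eqoP h eps eps0|h].
  have [X [_ hX]] := h _ eps0.
  (* The 1 makes the threshold positive, and X + 1 turns the strict inequality defining
     neighbourhoods of infinity into a large one. *)
  exists (Num.max 1 (X + 1)); first by rewrite lt_max ltr01.
  move=> t; rewrite ge_max => /andP[t1 tX].
  have Xt : X < t by apply: lt_le_trans tX; rewrite ltrDl.
  have := hX t Xt; rewrite /= ger0_norm ?normc_ge0//.
  by rewrite [X in _ <= _ * X]ger0_norm ?powR_ge0.
apply/eqoP => eps eps0; have [X0 X00 hX] := h _ eps0.
exists X0; split; first exact: num_real.
move=> t /ltW /hX; rewrite /= ger0_norm ?normc_ge0//.
by rewrite [X in _ -> _ <= _ * X]ger0_norm ?powR_ge0.
Qed.

(** GM is exploited for f before projecting: a component can be much smaller than f and need not be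
    GM itself, but its size and variation are dominated by those of f. *)
Lemma partial_hankel_real_uniform_cvg (proj : R[i] -> R) :
  (forall z, `|proj z| <= modulus z) ->
  (forall z w, `|proj z - proj w| <= modulus (z - w)) ->
  locally_integrable `]0, +oo[ (fun t => proj (f t)) ->
  leb.-integrable `]0, 1[ (EFin \o (fun t => t `^ nu * proj (f t))) ->
  (forall eps, 0 < eps -> exists2 X0, 0 < X0 &
    forall t, X0 <= t -> modulus (f t) <= eps * t `^ (mu - 1)) ->
  exists L : R -> R, forall e, 0 < e -> exists X, forall N r, X <= N -> 0 <= r ->
    `|L r - partial_hankel_real alpha nu mu (fun t => proj (f t)) N r| <= e.
Proof.
move=> pn pB lu u1 small.
apply: (@uniform_cauchy_real _ _ [set r | 0 <= r]) => e e0.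
have [D D0 [lambda l1 tv]] := GM_total_variation_le hloc hGM mu.
have [K K0 tail] := hankel_tail halpha hmunu D0.
have eK : 0 < e / K by rewrite divr_gt0.
have [X0 X00 fX] := small _ eK.
have l0 : 0 < lambda by apply: lt_trans l1.
have lX0 : 0 < lambda * X0 by rewrite mulr_gt0.
have gm : gm_tail mu D (e / K) (lambda * X0) (fun t => proj (f t)).
  split.
  - by move=> a b a0; exact: locally_integrable_itv.
  - move=> t Xt; apply: (le_trans (pn _)); apply: fX; apply: le_trans Xt.
    by rewrite ler_peMl ?(ltW X00) ?(ltW l1).
  - move=> x xX; apply: le_trans (tv _ _ eK X00 fX x xX).
    exact: (total_variation_le_complex (proj := proj)).
exists (lambda * X0) => M N r XM MN /= r0.
rewrite (partial_hankel_real_diff mu halpha lu u1)//; last exact: lt_le_trans XM.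
rewrite normrM (ger0_norm (powR_ge0 _ _)).
apply: (le_trans (tail _ _ _ lX0 eK gm r M N r0 XM MN)).
by rewrite mulrC divfK// gt_eqF.
Qed.

Lemma hankel_cvg_of_littleo :
  (fun M : R => modulus (f M) : R^o) =o_+oo (fun M : R => M `^ (mu - 1) : R^o) ->
  hankel_converges_uniformly alpha nu mu f [set r | 0 <= r].
Proof.
move=> /littleo_pinftyP small; case: hloc hL1 => lr li [ir ii].
have [L1 hL1r] : exists L : R -> R, forall e, 0 < e -> exists X, forall N r, X <= N -> 0 <= r ->
    `|L r - complex.Re (partial_hankel alpha nu mu f N r)| <= e.
  have ir' : leb.-integrable `]0, 1[ (EFin \o (fun t => t `^ nu * complex.Re (f t))).
    by apply: eq_integrable ir => // t _ /=; rewrite Re_rcM.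
  have [L h] := partial_hankel_real_uniform_cvg ler_Re_normc ler_ReB_normc lr ir' small.
  by exists L => e /h[X hX]; exists X => N r; rewrite Re_partial_hankel; exact: hX.
have [L2 hL2] : exists L : R -> R, forall e, 0 < e -> exists X, forall N r, X <= N -> 0 <= r ->
    `|L r - complex.Im (partial_hankel alpha nu mu f N r)| <= e.
  have ii' : leb.-integrable `]0, 1[ (EFin \o (fun t => t `^ nu * complex.Im (f t))).
    by apply: eq_integrable ii => // t _ /=; rewrite Im_rcM.
  have [L h] := partial_hankel_real_uniform_cvg ler_Im_normc ler_ImB_normc li ii' small.
  by exists L => e /h[X hX]; exists X => N r; rewrite Im_partial_hankel; exact: hX.
pose l r : R[i]^o := L1 r +i* L2 r.
have unif (e : R[i]) : 0 < e -> exists X : R, forall N r, X <= N -> 0 <= r ->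
    `|l r - partial_hankel alpha nu mu f N r| < e.
  rewrite ltcE /= => /andP[/eqP ei e0].
  (* In the order of R[i], 0 < e forces e to be real. The modulus is at most the sum of two
     component errors, each at most e / 3, hence strictly below e. *)
  have e3 : 0 < complex.Re e / 3 by rewrite divr_gt0.
  have [X1 h1] := hL1r _ e3; have [X2 h2] := hL2 _ e3.
  exists (Num.max X1 X2) => N r; rewrite ge_max => /andP[N1 N2] r0.
  rewrite normr_normc ltcE; apply/andP; split; first by apply/eqP.
  apply: (le_lt_trans (normc_le_ReIm _)); rewrite ReB ImB.
  apply: (le_lt_trans (lerD (h1 _ _ N1 r0) (h2 _ _ N2 r0))).
  by move: e3; move: (complex.Re e) => x; lra.
(* [hankel] is a [lim], identified with [l] only through pointwise convergence. *)
have hl r : 0 <= r -> hankel alpha nu mu f r = l r.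
  move=> r0; apply: cvg_lim; first exact: norm_hausdorff.
  apply/cvgrPdist_lt => e /unif[X hX].
  by exists X; split; [exact: num_real|move=> N /ltW XN; exact: hX].
move=> P /uniform_nbhs[E [entE EP]].
move: entE; rewrite -entourage_ballE => -[e /= e0 eE].
have [X hX] := unif e e0.
exists X; split; first exact: num_real.
move=> N /ltW XN; apply: EP => r /= r0; apply: eE => /=.
by rewrite hl// -ball_normE /=; exact: hX.
Qed.

End sufficiency.

(** * Necessity for nonnegative functions *)

Section necessity.
Context {R : realType}.
Local Notation leb := (@lebesgue_measure R).
Local Notation modulus := (@ComplexField.Normc.normc R).
Variables (alpha nu mu : R).
Hypothesis halpha : - (1 / 2) <= alpha.

Lemma ebesselj_ge_half : exists2 c, 0 < c &
  forall z, 0 <= z <= c -> 1 / 2 <= ebesselj alpha z.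
Proof.
have := continuous_ebesselj halpha (x := 0); rewrite /continuous_at ebesselj0//.
move/cvgrPdist_lt => /(_ (1 / 2)) []; first by rewrite divr_gt0.
move=> d /= d0 hd; exists (d / 2); first by rewrite divr_gt0.
move=> z /andP[z0 zd].
have zd' : `|0 - z| < d.
  rewrite sub0r normrN ger0_norm//; apply: (le_lt_trans zd).
  by rewrite ltr_pdivrMr// ltr_pMr// ltr1n.
by have := hd z zd'; rewrite /= ltr_norml => /andP[_ ?]; lra.
Qed.

Lemma Rintegral_ge_bound (u : R -> R) A a b : a <= b ->
  leb.-integrable `[a, b] (EFin \o u) ->
  (forall t, t \in `[a, b] -> A <= u t) ->
  A * (b - a) <= \int[leb]_(t in `[a, b]) u t.
Proof.
move=> ab iu uA.
have cA : {in `[a, b], continuous (fun _ : R => A)} by move=> t _; exact: cvg_cst.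
have -> : A * (b - a) = \int[leb]_(t in `[a, b]) A.
  have dA t : t \in `[a, b] -> is_derive t 1 ( *%R A) A.
    by move=> _; apply: is_derive_eq; rewrite /GRing.scale/=; ring.
  by rewrite (Rintegral_FTC2 ab dA cA) mulrBr.
apply: le_Rintegral => //; exact: (continuous_integrable_itv cA).
Qed.

Lemma ge0_Rintegral_subitv (u : R -> R) a b c d : a <= c -> c <= d -> d <= b ->
  leb.-integrable `[a, b] (EFin \o u) ->
  (forall t, t \in `[a, b] -> 0 <= u t) ->
  \int[leb]_(t in `[c, d]) u t <= \int[leb]_(t in `[a, b]) u t.
Proof.
move=> ac cd db iu u0; have ad := le_trans ac cd.
have iad := integrable_subitv (lexx a) db iu.
rewrite (Rintegral_itv_cat ad db iu) (Rintegral_itv_cat ac cd iad).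
rewrite -addrA addrCA lerDl addr_ge0// Rintegral_ge0// => t; rewrite /= in_itv/= => /andP[t1 t2].
  by apply: u0; rewrite in_itv/= t1 (le_trans t2)// (le_trans cd).
by apply: u0; rewrite in_itv/= t2 (le_trans _ t1).
Qed.

Variable f : R -> R[i].
Hypothesis hloc : clocally_integrable `]0, +oo[ f.
Hypothesis hGM : GM f.
Hypothesis hL1 : cintegrable `]0, 1[ (fun t => (t `^ nu)%:C * f t).
Hypothesis f_ge0 : forall t : R, 0 <= t -> 0 <= f t.

Let u t := complex.Re (f t).

Let u_ge0 t : 0 <= t -> 0 <= u t.
Proof. by move=> /f_ge0; rewrite lecE => /andP[]. Qed.

Let normc_u t : 0 <= t -> modulus (f t) = u t.
Proof.
move=> t0; have := u_ge0 t0; have := f_ge0 t0; rewrite lecE /u.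
case: (f t) => a b /= /andP[/eqP -> _] a0.
by rewrite expr0n addr0 sqrtr_sqr ger0_norm.
Qed.

Let u_integrable a b : 0 < a -> leb.-integrable `[a, b] (EFin \o u).
Proof. by case: hloc => lu _ a0; exact: locally_integrable_itv. Qed.

Lemma hankel_cauchy :
  hankel_converges_uniformly alpha nu mu f [set r | 0 <= r] ->
  forall e, 0 < e -> exists2 X, 0 < X & forall M N r, X <= M -> M <= N -> 0 <= r ->
    r `^ (mu + nu) * \int[leb]_(t in `[M, N]) (u t * bkernel alpha nu r t) <= e.
Proof.
move=> hu e e0; have e2 : 0 < e / 2 by rewrite divr_gt0.
(* Functions within e / 2 of the transform for all r >= 0, a uniform neighbourhood; two partial
   integrals in it differ by less than e. *)
pose P : set (R -> R[i]^o) :=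
  [set h | forall r, 0 <= r -> ball (hankel alpha nu mu f r) (e / 2)%:C (h r)].
have : (partial_hankel alpha nu mu f @ +oo) P.
  apply: hu; apply/uniform_nbhs.
  exists [set xy | ball xy.1 (e / 2)%:C xy.2]; split => //.
  rewrite -entourage_ballE; exists (e / 2)%:C => //=.
  by rewrite ltcR.
move=> [X [_ hX]]; exists (Num.max 1 (X + 1)); first by rewrite lt_max ltr01.
move=> M N r; rewrite ge_max => /andP[M1 MX] MN r0.
have lu : locally_integrable `]0, +oo[ u by case: hloc.
have iu : leb.-integrable `]0, 1[ (EFin \o (fun t => t `^ nu * u t)).
  by case: hL1 => ir _; apply: eq_integrable ir => // t _ /=; rewrite Re_rcM.
rewrite -(partial_hankel_real_diff mu halpha lu iu (lt_le_trans ltr01 M1) MN r0).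
have XM : X < M by apply: lt_le_trans MX; rewrite ltrDl.
have h1 := hX M XM r r0; have h2 := hX N (lt_le_trans XM MN) r r0.
move: h1 h2; rewrite -ball_normE /= !normr_normc !ltcR => h1 h2.
rewrite -!Re_partial_hankel.
have := le_lt_trans (ler_ReB_normc _ _) h1; have := le_lt_trans (ler_ReB_normc _ _) h2.
rewrite !ltr_norml => /andP[h3 h4] /andP[h5 h6].
move: (complex.Re (hankel _ _ _ _ _)) (complex.Re (partial_hankel _ _ _ _ N _))
  (complex.Re (partial_hankel _ _ _ _ M _)) h3 h4 h5 h6 => a b c *.
lra.
Qed.

(* Taking [r] of the order of [1 / x], the kernel [j (r t)] is bounded below on
   the whole window [x / lambda, 2 lambda x]. *)
Lemma hankel_window lambda : 1 < lambda ->
  hankel_converges_uniformly alpha nu mu f [set r | 0 <= r] ->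
  exists2 B, 0 < B & forall e, 0 < e -> exists2 X, 0 < X & forall x, X <= x ->
    \int[leb]_(t in `[x / lambda, 2 * lambda * x]) u t <= e * B * x `^ mu.
Proof.
move=> l1 hu; have [c c0 hc] := ebesselj_ge_half.
have l0 : 0 < lambda by apply: lt_trans l1.
(* The ratio N / M of the ends of the window, so that t^nu and N^nu agree on it up to the factor
   L^|nu|. *)
pose L := 2 * lambda * lambda.
have L0 : 0 < L by rewrite !mulr_gt0.
pose s := mu + nu.
exists (2 * L `^ `|nu| / c `^ s * (2 * lambda) `^ mu).
  have l20 : 0 < 2 * lambda by rewrite mulr_gt0.
  by rewrite mulr_gt0 ?powR_gt0// divr_gt0 ?powR_gt0// mulr_gt0 ?powR_gt0.
move=> e e0; have [X X0 hX] := hankel_cauchy hu e0.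
exists (lambda * X) => [|x xX]; first by rewrite mulr_gt0.
have x0 : 0 < x by apply: lt_le_trans xX; rewrite mulr_gt0.
pose N := 2 * lambda * x; pose M := x / lambda.
have M0 : 0 < M by rewrite divr_gt0.
have N0 : 0 < N by rewrite !mulr_gt0.
have MN : M <= N.
  apply: (@le_trans _ _ x); first by rewrite ler_pdivrMr// ler_peMr// ltW.
  by rewrite ler_peMl ?(ltW x0)// mulr_ege1 ?ler1n// ltW.
have L1 : 1 <= L by rewrite !mulr_ege1 ?ler1n// ltW.
have XM : X <= M by rewrite ler_pdivlMr// mulrC.
have r0 : 0 < c / N by rewrite divr_gt0.
have := hX M N (c / N) XM MN (ltW r0).
(* Lower bound of the kernel on the window: N^nu / L^|nu| for the power, 1/2 for j, since r t <= r N
   = c. Dividing e by (c / N)^s k yields the constant announced above. *)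
pose k := N `^ nu / L `^ `|nu| / 2.
have k0 : 0 < k by rewrite !divr_gt0 ?powR_gt0.
have ii : leb.-integrable `[M, N] (EFin \o (fun t => u t * bkernel alpha nu (c / N) t)).
  apply: integrable_mul_continuous; first exact: u_integrable.
  by move=> t; rewrite in_itv/= => /andP[xt _]; apply: continuous_bkernel => //; apply: lt_le_trans xt.
have ck : {in `[M, N], continuous (fun _ : R => k)} by move=> t _; exact: cvg_cst.
have low : (\int[leb]_(t in `[M, N]) u t) * k <=
    \int[leb]_(t in `[M, N]) (u t * bkernel alpha nu (c / N) t).
  rewrite -RintegralZr//; last exact: u_integrable.
  apply: le_Rintegral => //.
    exact: (integrable_mul_continuous (u_integrable _ M0) ck).
  move=> t /=; rewrite in_itv/= => /andP[Mt tN].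
  have t0 : 0 < t by apply: lt_le_trans Mt.
  rewrite ler_wpM2l ?u_ge0 ?(ltW t0)// /bkernel /k ler_pM//.
  - by rewrite divr_ge0 ?powR_ge0.
  - rewrite ler_pdivrMr ?powR_gt0// mulrC.
    apply: powR_comparable => //; apply/andP; split; first by rewrite ler_pdivrMr// (le_trans tN)// ler_peMr// ltW.
    move: Mt; rewrite ler_pdivrMr// => h.
    by rewrite /N /L -(mulrA _ lambda t) (mulrC lambda t) ler_wpM2l// mulr_ge0// ltW.
  - rewrite -div1r; apply: hc; rewrite mulr_ge0 ?(ltW r0) ?(ltW t0)//=.
    by rewrite mulrAC ler_pdivrMr// ler_pM2l.
move=> h; have {}h := le_trans (ler_wpM2l (powR_ge0 _ _) low) h.
have cs0 : 0 < c `^ s by rewrite powR_gt0.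
have Nm0 : 0 < N `^ mu by rewrite powR_gt0.
have kE : (c / N) `^ s * k = c `^ s / (2 * L `^ `|nu|) / N `^ mu.
  have -> : (c / N) `^ s = c `^ s / N `^ s.
    rewrite powRM ?invr_ge0 ?(ltW c0) ?(ltW N0)//.
    by rewrite -[N^-1]powR_inv1 ?(ltW N0)// -powRrM mulN1r powRN.
  rewrite /k /s (gt0_powRD mu nu N0).
  by field; rewrite !gt_eqF ?powR_gt0.
rewrite -/M -/N.
have NE : N `^ mu = (2 * lambda) `^ mu * x `^ mu.
  by rewrite /N powRM ?mulr_ge0 ?(ltW l0) ?(ltW x0).
rewrite [leRHS](_ : _ = e / ((c / N) `^ s * k)); last first.
  by rewrite kE NE; field; rewrite !gt_eqF ?powR_gt0 ?mulr_gt0.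
have rs0 : 0 < (c / N) `^ s by rewrite powR_gt0.
by rewrite ler_pdivlMr ?(mulr_gt0 rs0 k0)// mulrCA.
Qed.

(** By GM, u stays above u x - C J / x on [x, 2 x]; integrating over this interval of length x gives
    x u(x) <= I + C J <= (1 + C) I. The window of I contains both [x, 2 x] and the GM window of J,
    and I is o(x^mu). *)
Lemma littleo_of_hankel_cvg :
  hankel_converges_uniformly alpha nu mu f [set r | 0 <= r] ->
  (fun M : R => modulus (f M) : R^o) =o_+oo (fun M : R => M `^ (mu - 1) : R^o).
Proof.
move=> hu; apply/littleo_pinftyP => eps eps0.
have [C [lambda [C1 l1 gm]]] := hGM.
have [B B0 hB] := hankel_window l1 hu.
have C0 : 0 < C by apply: lt_trans C1.
have l0 : 0 < lambda by apply: lt_trans l1.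
have e0 : 0 < eps / ((1 + C) * B) by rewrite divr_gt0// mulr_gt0// addr_gt0.
have [X X0 hX] := hB _ e0.
exists X => // x Xx; have x0 : 0 < x by apply: lt_le_trans Xx.
rewrite normc_u ?(ltW x0)//.
set I := \int[leb]_(t in `[x / lambda, 2 * lambda * x]) u t.
have M0 : 0 < x / lambda by rewrite divr_gt0.
have Mx : x / lambda <= x by rewrite ler_pdivrMr// ler_peMr// ltW.
have x2 : x <= 2 * x by rewrite ler_peMl ?(ltW x0)// ler1n.
have xl : x <= lambda * x by rewrite ler_peMl ?(ltW x0)// ltW.
have iI b : leb.-integrable `[x / lambda, b] (EFin \o u) by exact: u_integrable.
have u0 b t : t \in `[x / lambda, b] -> 0 <= u t.
  by rewrite in_itv/= => /andP[+ _] => h; apply: u_ge0; apply: le_trans h; exact: ltW.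
have le1 : \int[leb]_(t in `[x, 2 * x]) u t <= I.
  apply: ge0_Rintegral_subitv => //; last exact: u0.
  by rewrite -mulrA ler_wpM2l.
pose J := \int[leb]_(t in `[x / lambda, lambda * x]) u t.
have le2 : J <= I.
  apply: ge0_Rintegral_subitv => //; last exact: u0.
    exact: le_trans xl.
  by rewrite -mulrA ler_peMl ?ler1n// mulr_ge0 ?(ltW l0) ?(ltW x0).
have tv : (ctotal_variation x (2 * x)%R f <= (C / x * J)%:E)%E.
  apply: (le_trans (gm x x0)); rewrite (EFinM (C / x) J).
  rewrite (_ : (J%:E = \int[leb]_(t in `[(x / lambda)%R, (lambda * x)%R]) (u t)%:E)%E).
    rewrite lee_wpmul2l ?lee_fin ?divr_ge0 ?(ltW C0) ?(ltW x0)//.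
    rewrite (_ : (\int[leb]_(t in _) _ = \int[leb]_(t in `[(x / lambda)%R, (lambda * x)%R]) (u t)%:E)%E)//.
    apply: eq_integral => t /set_mem; rewrite /= in_itv/= => /andP[Mt _].
    by rewrite normc_u// (le_trans (ltW M0)).
  by rewrite /J /Rintegral fineK//; apply: integrable_fin_num => //; exact: iI.
have ut t : t \in `[x, 2 * x] -> u x - C / x * J <= u t.
  rewrite in_itv/= => /andP[xt t2].
  have : (`|u t - u x|%:E <= (C / x * J)%:E)%E.
    apply: le_trans tv; apply: le_trans (total_variation_le_complex f x (2 * x) ler_ReB_normc).
    apply: (le_trans (total_variation_ge u xt)).
    by rewrite (total_variationD _ xt t2) leeDl// total_variation_ge0.
  by rewrite lee_fin ler_norml => /andP[h _]; move: h; move: (C / x * J) => w; lra.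
have := Rintegral_ge_bound x2 (u_integrable _ x0) ut.
rewrite (_ : 2 * x - x = x); last by ring.
rewrite mulrBl mulrAC divfK ?gt_eqF// lerBlDr => h.
have {}h : u x * x <= (1 + C) * I.
  by apply: (le_trans h); rewrite [leRHS]mulrDl mul1r lerD// ler_wpM2l// ltW.
rewrite -(ler_pM2r x0); apply: (le_trans h).
apply: (le_trans (ler_wpM2l _ (hX x Xx))); first by rewrite addr_ge0 ?(ltW C0).
rewrite (gt0_powRB1 _ x0) le_eqVlt; apply/orP; left; apply/eqP.
by field; rewrite !gt_eqF ?addr_gt0.
Qed.

End necessity.

Theorem theorem5p3 (R : realType) (alpha nu mu : R) (f : R -> R[i])
    (halpha : - (1 / 2) <= alpha)
    (hmunu : 0 < mu + nu < alpha + 3 / 2)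
    (hbv : locally_bounded_variation f)
    (hloc : clocally_integrable `]0, +oo[ f)
    (hGM : GM f)
    (hL1 : cintegrable `]0, 1[ (fun t => (t `^ nu)%:C * f t)) :
  ((fun M : R => ComplexField.Normc.normc (f M) : R^o)
      =o_+oo (fun M : R => M `^ (mu - 1) : R^o) ->
   hankel_converges_uniformly alpha nu mu f [set r | 0 <= r]) /\
  ((forall t : R, 0 <= t -> 0 <= f t) ->
   hankel_converges_uniformly alpha nu mu f [set r | 0 <= r] ->
   (fun M : R => ComplexField.Normc.normc (f M) : R^o)
      =o_+oo (fun M : R => M `^ (mu - 1) : R^o)).
Proof.
split; first exact: hankel_cvg_of_littleo.
by move=> f_ge0; exact: littleo_of_hankel_cvg.
Qed.
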